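(* Let $(K,\mathsf R)$ be a quasitriangular Hopf $*$-algebra over $\mathbb C$ with $\mathsf R^{*\otimes *}=\overline{\mathsf R}$, let $L$ be a braided Hopf $*$-algebra associated with $(K,\mathsf R)$, with braided antipode $S_L$, let $A$ be a $K$-module $*$-algebra, and let $\blacktriangleright_A:L\otimes A\to A$ be an action of the braided Hopf algebra $L$ on the $K$-module algebra $A$. Then the compatibility condition $$(x\blacktriangleright_A a)^*=\big(\overline{\mathsf R}^{\alpha}\triangleright_L S_L^{-1}(x^* )\big)\blacktriangleright_A\big(\overline{\mathsf R}_\alpha\triangleright_A a^*\big),\qquad x\in L,\ a\in A,$$ between the action and the $*$-structures is well-defined, that is, the map $$x\succ_A a:=\Big[\big(\overline{\mathsf R}^{\alpha}\triangleright_L S_L^{-1}(x^* )\big)\blacktriangleright_A\big(\overline{\mathsf R}_\alpha\triangleright_A a^*\big)\Big]^*$$ is an action of the braided Hopf algebra $L$ on the $K$-module algebra $A$ (so that the compatibility condition amounts to requiring that this action coincides with $\blacktriangleright_A$).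
   Context: All vector spaces are over $\mathbb C$; $*$-structures are antilinear involutions, antimultiplicative on algebras. A Hopf $*$-algebra $K$ has $\Delta(k^* )=\Delta(k)^{*\otimes *}$. A $K$-module $*$-algebra $A$ is a $K$-module algebra with $*$-structure such that $(k\triangleright a)^*=S^{-1}(k^* )\triangleright a^*$. Sweedler notation $\Delta(k)=k_{(1)}\otimes k_{(2)}$ is used. $\mathsf R=\mathsf R^\alpha\otimes\mathsf R_\alpha\in K\otimes K$ (sum implicit) is the universal $R$-matrix: $\Delta^{cop}(k)=\mathsf R\Delta(k)\overline{\mathsf R}$, $(\Delta\otimes\mathrm{id})\mathsf R=\mathsf R_{13}\mathsf R_{23}$, $(\mathrm{id}\otimes\Delta)\mathsf R=\mathsf R_{13}\mathsf R_{12}$, with inverse $\overline{\mathsf R}=\overline{\mathsf R}^\alpha\otimes\overline{\mathsf R}_\alpha$. For a $K$-module algebra $L$, $L\boxtimes L$ is the vector space $L\otimes L$ with product $(x\otimes y)(x'\otimes y')=x(\mathsf R_\alpha\triangleright x')\otimes(\mathsf R^\alpha\triangleright y)y'$ and action $k\triangleright(x\boxtimes y)=(k_{(1)}\triangleright x)\boxtimes(k_{(2)}\triangleright y)$. A braided Hopf algebra $L$ associated with $(K,\mathsf R)$ is a $K$-module algebra and $K$-module coalgebra $(L,\Delta_L,\varepsilon_L)$ such that $\varepsilon_L:L\to\mathbb C$ and $\Delta_L:L\to L\boxtimes L$ are algebra maps, with a $K$-module map $S_L:L\to L$ satisfying $m_L(\mathrm{id}\otimes S_L)\Delta_L=\eta_L\varepsilon_L=m_L(S_L\otimes\mathrm{id})\Delta_L$.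 A braided Hopf $*$-algebra is a braided Hopf algebra $L$ which is a $K$-module $*$-algebra with $\Delta_L(x^* )=(\Delta_L(x))^*$, where $(x\boxtimes y)^*=(\mathsf R_\alpha\triangleright x^* )\boxtimes(\mathsf R^\alpha\triangleright y^* )$ on $L\boxtimes L$; its braided antipode is invertible. An action of a braided Hopf algebra $L$ on a $K$-module algebra $A$ is a linear map $\blacktriangleright:L\otimes A\to A$ making $A$ an $L$-module, which is $K$-equivariant, $k\triangleright_A(x\blacktriangleright a)=(k_{(1)}\triangleright_L x)\blacktriangleright(k_{(2)}\triangleright_A a)$, satisfies $x\blacktriangleright 1_A=\varepsilon_L(x)1_A$ and, with $\Delta_L(x)=x_{(1)}\boxtimes x_{(2)}$, $x\blacktriangleright(aa')=(x_{(1)}\blacktriangleright(\mathsf R_\alpha\triangleright_A a))\,((\mathsf R^\alpha\triangleright_L x_{(2)})\blacktriangleright a')$. *)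

(* Defs.v *)
From HB Require Import structures.
From mathcomp Require Import all_boot all_order all_algebra.
From mathcomp Require Import generic_quotient.
From mathcomp Require Import boolp classical_sets functions reals.
From mathcomp Require Import complex.

Set Implicit Arguments.
Unset Strict Implicit.
Unset Printing Implicit Defensive.

Import GRing.Theory.
Local Open Scope quotient_scope.
Local Open Scope ring_scope.
Local Open Scope complex_scope.

Reserved Notation "v ⊗ w" (at level 40, left associativity).
Reserved Notation "k ▹ a" (at level 35, right associativity).
Reserved Notation "\tsum_ ( x ⊗ y <- t ) F"
  (at level 41, x name, y name, t at level 200, F at level 41,
   format "'[' \tsum_ ( x  ⊗  y  <-  t ) '/  '  F ']'").

(* Unital associative algebras, the zero algebra included (the library's     *)
(* algType has 1 != 0).                                                      *)
HB.mixin Record Lmodule_isUnitalAlgebra (F : pzRingType) A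
    of GRing.Lmodule F A := {
  ualg_one : A;
  ualg_mul : A -> A -> A;
  ualg_mulA : associative ualg_mul;
  ualg_mul1r : left_id ualg_one ualg_mul;
  ualg_mulr1 : right_id ualg_one ualg_mul;
  ualg_mulDl : left_distributive ualg_mul +%R;
  ualg_mulDr : right_distributive ualg_mul +%R;
  ualg_scaleAl :
    forall (c : F) (x y : A), c *: ualg_mul x y = ualg_mul (c *: x) y;
  ualg_scaleAr :
    forall (c : F) (x y : A), c *: ualg_mul x y = ualg_mul x (c *: y)
}.

#[short(type="unitalAlgType")]
HB.structure Definition UnitalAlgebra (F : pzRingType) :=
  {A of GRing.Lmodule F A & Lmodule_isUnitalAlgebra F A}.

HB.instance Definition _ (F : pzRingType) (A : unitalAlgType F) :=
  GRing.Zmodule_isPzRing.Build (UnitalAlgebra.sort A) (@ualg_mulA F A)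
    (@ualg_mul1r F A) (@ualg_mulr1 F A) (@ualg_mulDl F A) (@ualg_mulDr F A).

(** Tensor products: finite formal sums of pairs, modulo bilinearity. *)

Section TensorDef.
Variables (F : fieldType) (V W : lmodType F).
Implicit Types (s t : seq (V * W)).

Inductive tensor_rel : seq (V * W) -> seq (V * W) -> Prop :=
| trel_refl s : tensor_rel s s
| trel_sym s t : tensor_rel s t -> tensor_rel t s
| trel_trans s t u : tensor_rel s t -> tensor_rel t u -> tensor_rel s u
| trel_cat s s' t t' :
    tensor_rel s s' -> tensor_rel t t' -> tensor_rel (s ++ t) (s' ++ t')
| trel_catC s t : tensor_rel (s ++ t) (t ++ s)
| trel_addl v v' w : tensor_rel [:: (v + v', w)] [:: (v, w); (v', w)]
| trel_addr v w w' : tensor_rel [:: (v, w + w')] [:: (v, w); (v, w')]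
| trel_scale c v w : tensor_rel [:: (c *: v, w)] [:: (v, c *: w)]
| trel_zero w : tensor_rel [:: (0, w)] [::].

Definition tensor_relb s t : bool := `[< tensor_rel s t >].

Lemma tensor_relb_refl : reflexive tensor_relb.
Proof. by move=> s; apply/asboolP/trel_refl. Qed.

Lemma tensor_relb_sym : symmetric tensor_relb.
Proof. by move=> s t; apply/asboolP/asboolP; apply: trel_sym. Qed.

Lemma tensor_relb_trans : transitive tensor_relb.
Proof.
by move=> t s u /asboolP st /asboolP tu; apply/asboolP/(trel_trans st tu).
Qed.

Canonical tensor_equiv :=
  EquivRel tensor_relb tensor_relb_refl tensor_relb_sym tensor_relb_trans.

Definition tensor := {eq_quot tensor_equiv}.
HB.instance Definition _ := Choice.on tensor.
HB.instance Definition _ := EqQuotient.on tensor.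

Implicit Types (x y z : tensor).

Definition tclass s : tensor := \pi s.

Lemma tclassP s t : tclass s = tclass t <-> tensor_rel s t.
Proof.
split=> [/eqmodP|st]; first by rewrite /= => /asboolP.
by apply/eqmodP; apply/asboolP.
Qed.

Lemma tclassK x : tclass (repr x) = x. Proof. exact: reprK. Qed.

Lemma tensor_rel_repr s : tensor_rel (repr (tclass s)) s.
Proof. by apply/tclassP; rewrite tclassK. Qed.

Definition tensor_add x y := tclass (repr x ++ repr y).
Definition tensor_opp x := tclass [seq (- p.1, p.2) | p <- repr x].
Definition tensor_scale (c : F) x := tclass [seq (c *: p.1, p.2) | p <- repr x].

Lemma tensor_rel_map (f : V -> V) s t :
  (forall v v', f (v + v') = f v + f v') ->
  (forall c v, f (c *: v) = c *: f v) ->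
  tensor_rel s t ->
  tensor_rel [seq (f p.1, p.2) | p <- s] [seq (f p.1, p.2) | p <- t].
Proof.
move=> fD fZ; elim=> {s t} /=.
- by move=> s; exact: trel_refl.
- by move=> s t _; exact: trel_sym.
- by move=> s t u _ st _; exact: trel_trans.
- by move=> s s' t t' _ st _ st'; rewrite !map_cat; exact: trel_cat.
- by move=> s t; rewrite !map_cat; exact: trel_catC.
- by move=> v v' w; rewrite fD; exact: trel_addl.
- by move=> v w w'; exact: trel_addr.
- by move=> c v w; rewrite fZ; exact: trel_scale.
- move=> w; have -> : f 0 = 0 by rewrite -(scale0r (0 : V)) fZ !scale0r.
  exact: trel_zero.
Qed.

Lemma tclassD s t : tensor_add (tclass s) (tclass t) = tclass (s ++ t).
Proof. by apply/tclassP/trel_cat; exact: tensor_rel_repr. Qed.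

Lemma tclassN s : tensor_opp (tclass s) = tclass [seq (- p.1, p.2) | p <- s].
Proof.
apply/tclassP; apply: (tensor_rel_map (f := -%R)) (tensor_rel_repr s).
  by move=> v v'; rewrite opprD.
by move=> c v; rewrite scalerN.
Qed.

Lemma tclassZ c s :
  tensor_scale c (tclass s) = tclass [seq (c *: p.1, p.2) | p <- s].
Proof.
apply/tclassP; apply: (tensor_rel_map (f := *:%R c)) (tensor_rel_repr s).
  by move=> v v'; rewrite scalerDr.
by move=> d v; rewrite !scalerA mulrC.
Qed.

Lemma tensor_ind (P : tensor -> Prop) : (forall s, P (tclass s)) -> forall x, P x.
Proof. by move=> h x; rewrite -(tclassK x). Qed.

Lemma tensor_addA : associative tensor_add.
Proof.
elim/tensor_ind=> s; elim/tensor_ind=> t; elim/tensor_ind=> u.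
by rewrite !tclassD catA.
Qed.

Lemma tensor_addC : commutative tensor_add.
Proof.
elim/tensor_ind=> s; elim/tensor_ind=> t.
by rewrite !tclassD; apply/tclassP/trel_catC.
Qed.

Lemma tensor_add0 : left_id (tclass [::]) tensor_add.
Proof. by elim/tensor_ind=> s; rewrite tclassD. Qed.

Lemma tensor_addN : left_inverse (tclass [::]) tensor_opp tensor_add.
Proof.
elim/tensor_ind; elim=> [|[v w] s IHs]; rewrite tclassN tclassD //=.
rewrite -[RHS]IHs tclassN tclassD; apply/tclassP.
set t := map _ s.
rewrite -[(- v, w) :: _]cat1s -[(v, w) :: s]cat1s.
apply: (@trel_trans _ (([:: (- v, w)] ++ [:: (v, w)]) ++ (t ++ s))).
  rewrite -!catA; apply: trel_cat; first exact: trel_refl.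
  rewrite !catA; apply: trel_cat; [exact: trel_catC | exact: trel_refl].
rewrite -[t ++ s]cat0s; apply: trel_cat; last exact: trel_refl.
apply: (trel_trans (trel_sym (trel_addl (- v) v w))).
by rewrite addNr; exact: trel_zero.
Qed.

HB.instance Definition _ :=
  GRing.isZmodule.Build tensor tensor_addA tensor_addC tensor_add0 tensor_addN.

Lemma tensor_scaleA a b x :
  tensor_scale a (tensor_scale b x) = tensor_scale (a * b) x.
Proof.
elim/tensor_ind: x => s; rewrite !tclassZ -map_comp; congr tclass.
by apply: eq_map => p /=; rewrite scalerA.
Qed.

Lemma tensor_scale1 : left_id 1 tensor_scale.
Proof.
elim/tensor_ind=> s; rewrite tclassZ; congr tclass.
by rewrite -[RHS]map_id; apply: eq_map => -[v w] /=; rewrite scale1r.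
Qed.

Lemma tensor_scaleDr : right_distributive tensor_scale +%R.
Proof.
move=> c; elim/tensor_ind=> s; elim/tensor_ind=> t.
rewrite -[_ + _]/(tensor_add _ _) -[RHS]/(tensor_add _ _).
by rewrite tclassD !tclassZ tclassD map_cat.
Qed.

Lemma tensor_scaleDl x : {morph tensor_scale^~ x : a b / a + b}.
Proof.
move=> a b; elim/tensor_ind: x => s.
rewrite -[RHS]/(tensor_add _ _) !tclassZ tclassD.
elim: s => [//|[v w] s /tclassP IHs]; apply/tclassP => /=.
rewrite scalerDl -[(_, w) :: map _ s]cat1s.
apply: (trel_trans (trel_cat (trel_addl _ _ _) IHs)) => /=.
set p := (a *: v, w); set q := (b *: v, w).
set sa := map _ s; set sb := map _ s.
apply: (@trel_cat [:: p] [:: p]); first exact: trel_refl.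
rewrite -[q :: (sa ++ _)]/(([:: q] ++ sa) ++ sb) -[q :: sb]cat1s catA.
by apply: trel_cat; [exact: trel_catC | exact: trel_refl].
Qed.

HB.instance Definition _ := GRing.Zmodule_isLmodule.Build F tensor
  tensor_scaleA tensor_scale1 tensor_scaleDr tensor_scaleDl.

Definition tens (v : V) (w : W) : tensor := tclass [:: (v, w)].

(* Sweedler sum: if t = sum_i v_i ⊗ w_i then tsum t f = sum_i f v_i w_i.     *)
(* It is evaluated on a chosen decomposition of t, which is immaterial as    *)
(* soon as f is biadditive and balanced (e.g. bilinear, or antilinear in     *)
(* both variables): see tsumE.                                               *)
Definition tsum (X : nmodType) (t : tensor) (f : V -> W -> X) : X :=
  \sum_(p <- repr t) f p.1 p.2.

Lemma tensorE s : tclass s = \sum_(p <- s) tens p.1 p.2.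
Proof.
elim: s => [|[v w] s IHs]; first by rewrite big_nil.
by rewrite big_cons -IHs -[RHS]/(tensor_add _ _) tclassD.
Qed.

Lemma tsumE (X : zmodType) (f : V -> W -> X) s :
  (forall w, {morph f^~ w : v v' / v + v'}) ->
  (forall v, {morph f v : w w' / w + w'}) ->
  (forall c v w, f (c *: v) w = f v (c *: w)) ->
  tsum (\sum_(p <- s) tens p.1 p.2) f = \sum_(p <- s) f p.1 p.2.
Proof.
move=> fDl fDr fZ; rewrite -tensorE /tsum.
move: (repr _) (tensor_rel_repr s) => r; elim=> {r s} //=.
- by move=> t t' u _ -> _ ->.
- by move=> t t' u u' _ e _ e'; rewrite !big_cat /= e e'.
- by move=> t u; rewrite !big_cat /= addrC.
- by move=> v v' w; rewrite !big_cons !big_nil /= !addr0 fDl.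
- by move=> v w w'; rewrite !big_cons !big_nil /= !addr0 fDr.
- by move=> c v w; rewrite !big_cons !big_nil /= fZ.
- move=> w; rewrite big_cons !big_nil /= addr0.
  by apply: (addrI (f 0 w)); rewrite -fDl !addr0.
Qed.

End TensorDef.

Notation "V ⊗ W" := (tensor V W) : type_scope.
Notation "v ⊗ w" := (tens v w) : ring_scope.
Notation "\tsum_ ( x ⊗ y <- t ) F" := (tsum t (fun x y => F)) : ring_scope.

Definition is_bilinear (F : fieldType) (U V W : lmodType F) (f : U -> V -> W) :=
  (forall v, linear (f^~ v)) /\ (forall u, linear (f u)).

Definition inv_map (F : fieldType) (V : lmodType F) (f : V -> V) : V -> V :=
  'pinv_(fun=> 0) [set: V]%classic f.

Lemma inv_mapK (F : fieldType) (V : lmodType F) (f : V -> V) :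
  bijective f -> cancel f (inv_map f) /\ cancel (inv_map f) f.
Proof.
move=> fb; have fi := bij_inj fb; case: (fb) => g fg gf.
have fK : cancel (inv_map f) f.
  by move=> x; apply: pinvK; apply/mem_set; exists (g x).
by split=> // x; apply: fi; exact: fK.
Qed.

Definition tone (F : fieldType) (A B : unitalAlgType F) : A ⊗ B :=
  (1 : A) ⊗ (1 : B).

Definition tmul (F : fieldType) (A B : unitalAlgType F) (s t : A ⊗ B) : A ⊗ B :=
  \tsum_(a ⊗ b <- s) \tsum_(a' ⊗ b' <- t) (a * a') ⊗ (b * b').

Definition tflip (F : fieldType) (V W : lmodType F) (t : V ⊗ W) : W ⊗ V :=
  \tsum_(v ⊗ w <- t) w ⊗ v.

Section Coalgebra.
Variables (F : fieldType) (V : lmodType F).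

Record is_coalgebra (D : V -> V ⊗ V) (e : V -> F) : Prop := {
  coalg_coassoc : forall v,
    \tsum_(x ⊗ y <- D v) \tsum_(x1 ⊗ x2 <- D x) x1 ⊗ (x2 ⊗ y) =
    \tsum_(x ⊗ y <- D v) x ⊗ D y;
  coalg_counitl : forall v, \tsum_(x ⊗ y <- D v) e x *: y = v;
  coalg_counitr : forall v, \tsum_(x ⊗ y <- D v) e y *: x = v
}.

End Coalgebra.

Record hopfAlgebra (R : realType) := HopfAlgebra {
  hopf_alg :> unitalAlgType R[i];
  Delta : {linear hopf_alg -> (hopf_alg ⊗ hopf_alg)%type};
  eps : {scalar hopf_alg};
  antipode : {linear hopf_alg -> hopf_alg};
  hopf_coalg : is_coalgebra Delta eps;
  DeltaM : forall k h : hopf_alg, Delta (k * h) = tmul (Delta k) (Delta h);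
  Delta1 : Delta 1 = tone _ _;
  epsM : forall k h : hopf_alg, eps (k * h) = eps k * eps h;
  eps1 : eps 1 = 1;
  antipode_r : forall k : hopf_alg,
    \tsum_(h ⊗ l <- Delta k) h * antipode l = eps k *: (1 : hopf_alg);
  antipode_l : forall k : hopf_alg,
    \tsum_(h ⊗ l <- Delta k) antipode h * l = eps k *: (1 : hopf_alg)
}.

Arguments Delta {R _}.
Arguments eps {R _}.
Arguments antipode {R _}.

(* rmx is R = R^α ⊗ R_α, and rmxV is its inverse. *)
Record qtHopfAlgebra (R : realType) := QtHopfAlgebra {
  qt_hopf :> hopfAlgebra R;
  rmx : qt_hopf ⊗ qt_hopf;
  rmxV : qt_hopf ⊗ qt_hopf;
  rmxK : tmul rmx rmxV = tone _ _;
  rmxVK : tmul rmxV rmx = tone _ _;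
  rmx_cop : forall k : qt_hopf,
    tflip (Delta k) = tmul (tmul rmx (Delta k)) rmxV;
  (* (Delta ⊗ id) R = R13 R23, in (K ⊗ K) ⊗ K *)
  rmx_Deltal :
    \tsum_(r ⊗ s <- rmx) Delta r ⊗ s =
    \tsum_(r ⊗ s <- rmx) \tsum_(r' ⊗ s' <- rmx) (r ⊗ r') ⊗ (s * s');
  (* (id ⊗ Delta) R = R13 R12, in K ⊗ (K ⊗ K) *)
  rmx_Deltar :
    \tsum_(r ⊗ s <- rmx) r ⊗ Delta s =
    \tsum_(r ⊗ s <- rmx) \tsum_(r' ⊗ s' <- rmx) (r * r') ⊗ (s' ⊗ s)
}.

Arguments rmx {R} _.
Arguments rmxV {R} _.

Definition is_star (R : realType) (V : lmodType R[i]) (st : V -> V) :=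
  linear_for (conjc \; *:%R) st /\ involutive st.

Definition is_star_alg (R : realType) (A : unitalAlgType R[i]) (st : A -> A) :=
  is_star st /\ forall x y, st (x * y) = st y * st x.

Record qtHopfStarAlgebra (R : realType) := QtHopfStarAlgebra {
  qts_qt :> qtHopfAlgebra R;
  kstar : qts_qt -> qts_qt;
  kstar_star : is_star_alg kstar;
  Delta_kstar : forall k : qts_qt,
    Delta (kstar k) = \tsum_(h ⊗ l <- Delta k) kstar h ⊗ kstar l
}.

Arguments kstar {R _}.

Section ModuleAlgebra.
Variable (R : realType).

Record moduleAlgebra (K : hopfAlgebra R) := ModuleAlgebra {
  mod_alg :> unitalAlgType R[i];
  kact : K -> mod_alg -> mod_alg;
  kact_bilinear : is_bilinear kact;
  kact1 : forall a, kact 1 a = a;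
  kactM : forall k h a, kact (k * h) a = kact k (kact h a);
  kact_unit : forall k, kact k 1 = eps k *: (1 : mod_alg);
  kact_mul : forall k (a b : mod_alg),
    kact k (a * b) = \tsum_(h ⊗ l <- Delta k) kact h a * kact l b
}.

End ModuleAlgebra.

Notation "k ▹ a" := (kact k a) : ring_scope.

(* The antipode of a Hopf *-algebra is automatically bijective, with inverse *)
(* k |-> S(k^* )^*, so that inv_map antipode is a genuine inverse.           *)
Definition is_module_star (R : realType) (K : qtHopfStarAlgebra R)
    (A : moduleAlgebra K) (st : A -> A) :=
  is_star_alg st /\
  forall k a, st (k ▹ a) = inv_map antipode (kstar k) ▹ st a.

Record moduleStarAlgebra (R : realType) (K : qtHopfStarAlgebra R) :=
  ModuleStarAlgebra {
  ms_alg :> moduleAlgebra K;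
  mstar : ms_alg -> ms_alg;
  mstar_star : is_module_star mstar
}.

Arguments mstar {R K _}.

Section BraidedTensor.
Variables (R : realType) (K : qtHopfAlgebra R) (L : moduleAlgebra K).

Definition bmul (s t : L ⊗ L) : L ⊗ L :=
  \tsum_(x ⊗ y <- s) \tsum_(x' ⊗ y' <- t) \tsum_(r ⊗ r' <- rmx K)
    (x * (r' ▹ x')) ⊗ ((r ▹ y) * y').

(* The diagonal action k ▹ (x ⊠ y) = (k_(1) ▹ x) ⊠ (k_(2) ▹ y). *)
Definition bact (k : K) (t : L ⊗ L) : L ⊗ L :=
  \tsum_(x ⊗ y <- t) \tsum_(h ⊗ l <- Delta k) (h ▹ x) ⊗ (l ▹ y).

Definition btensor_star (st : L -> L) (t : L ⊗ L) : L ⊗ L :=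
  \tsum_(x ⊗ y <- t) \tsum_(r ⊗ r' <- rmx K) (r' ▹ st x) ⊗ (r ▹ st y).

End BraidedTensor.

Record braidedHopfAlgebra (R : realType) (K : qtHopfAlgebra R) :=
  BraidedHopfAlgebra {
  bh_alg :> moduleAlgebra K;
  bDelta : {linear bh_alg -> (bh_alg ⊗ bh_alg)%type};
  beps : {scalar bh_alg};
  bantipode : {linear bh_alg -> bh_alg};
  bh_coalg : is_coalgebra bDelta beps;
  bDelta_kact : forall (k : K) (x : bh_alg), bDelta (k ▹ x) = bact k (bDelta x);
  beps_kact : forall (k : K) (x : bh_alg), beps (k ▹ x) = eps k * beps x;
  bDeltaM : forall x y : bh_alg, bDelta (x * y) = bmul (bDelta x) (bDelta y);
  bDelta1 : bDelta 1 = tone _ _;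
  bepsM : forall x y : bh_alg, beps (x * y) = beps x * beps y;
  beps1 : beps 1 = 1;
  bantipode_kact : forall (k : K) (x : bh_alg), bantipode (k ▹ x) = k ▹ bantipode x;
  bantipode_r : forall x : bh_alg,
    \tsum_(y ⊗ z <- bDelta x) y * bantipode z = beps x *: (1 : bh_alg);
  bantipode_l : forall x : bh_alg,
    \tsum_(y ⊗ z <- bDelta x) bantipode y * z = beps x *: (1 : bh_alg)
}.

Arguments bDelta {R K _}.
Arguments beps {R K _}.
Arguments bantipode {R K _}.

Record braidedHopfStarAlgebra (R : realType) (K : qtHopfStarAlgebra R) :=
  BraidedHopfStarAlgebra {
  bhs_bh :> braidedHopfAlgebra K;
  bstar : bhs_bh -> bhs_bh;
  bstar_star : is_module_star bstar;
  bDelta_bstar : forall x, bDelta (bstar x) = btensor_star bstar (bDelta x);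
  bantipode_bij : bijective (@bantipode R K bhs_bh)
}.

Arguments bstar {R K _}.

Record is_braided_action (R : realType) (K : qtHopfAlgebra R)
    (L : braidedHopfAlgebra K) (A : moduleAlgebra K) (act : L -> A -> A) :
    Prop := {
  bract_bilinear : is_bilinear act;
  bract1 : forall a, act 1 a = a;
  bractM : forall x y a, act (x * y) a = act x (act y a);
  bract_kact : forall (k : K) x a,
    k ▹ act x a = \tsum_(h ⊗ l <- Delta k) act (h ▹ x) (l ▹ a);
  bract_unit : forall x, act x 1 = beps x *: (1 : A);
  bract_mul : forall x (a b : A),
    act x (a * b) =
    \tsum_(y ⊗ z <- bDelta x) \tsum_(r ⊗ r' <- rmx K)
      act y (r' ▹ a) * act (r ▹ z) b
}.

Section StarCompatibility.
Variables (R : realType) (K : qtHopfStarAlgebra R).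
Variables (L : braidedHopfStarAlgebra K) (A : moduleStarAlgebra K).

Definition compat_rhs (act : L -> A -> A) (x : L) (a : A) : A :=
  \tsum_(q ⊗ q' <- rmxV K)
    act (q ▹ inv_map bantipode (bstar x)) (q' ▹ mstar a).

Definition star_compatible (act : L -> A -> A) :=
  forall x a, mstar (act x a) = compat_rhs act x a.

Definition succ_act (act : L -> A -> A) (x : L) (a : A) : A :=
  mstar (compat_rhs act x a).

End StarCompatibility.

(* Main.v *)
Require Import Defs.
From mathcomp Require Import all_boot all_algebra reals complex.

(** The star-conjugate (x ≻ a)^* is computed leg by leg. Write Rbar for the
    inverse R-matrix and u = S_L^{-1}(x^* ), so that (x ≻ a)^* is Rbar applied to
    u ⊗ a^* followed by the action of L on A. The braided antipode reverses
    products and coproducts up to a braiding; for u the braiding in the coproduct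
    cancels the R in Delta_L(x^* ), leaving Delta_L(u) = u_2 ⊗ u_1, while u is
    multiplicative up to Rbar. Then
    - (xy) ≻ a = x ≻ (y ≻ a) is the Yang-Baxter equation for Rbar;
    - K-equivariance is Delta(h) Rbar = Rbar Delta^cop(h);
    - on a product, numbering the legs u_2, u_1, b^*, a^*, one side carries
      R_23 Rbar_23 Rbar_13 Rbar_24 Rbar_14 and the other Rbar_13 Rbar_24 Rbar_14,
      the last factor coming from (S^{-1}∘* )^{⊗2} R = Rbar.

    An identity between two elements of a tensor power is used throughout in the
    equivalent form: every multilinear f has the same Sweedler sum over both. *)

Set Implicit Arguments.
Unset Strict Implicit.
Unset Printing Implicit Defensive.

Import GRing.Theory.
Local Open Scope ring_scope.

(** * Multilinearity of Sweedler sums *)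

Section Linear.
Variables (F : fieldType).
Implicit Types (U V W X Y : lmodType F).

Lemma lin_id V : linear (fun v : V => v).
Proof. by []. Qed.

Lemma lin_comp U V W (g : {linear V -> W}) (f : U -> V) :
  linear f -> linear (fun u => g (f u)).
Proof. by move=> fP c u v; rewrite fP linearP. Qed.

Lemma lin_scal U V W (e : {scalar V}) (f : U -> V) (w : W) :
  linear f -> linear (fun u => e (f u) *: w).
Proof.
by move=> fP c u v; rewrite fP linearP /= scalerDl scalerA.
Qed.

(** The codomain is the regular module [F^o], so that counits can enter Sweedler sums like any other
    linear map. *)
Lemma lin_form U V (e : {scalar V}) (f : U -> V) :
  linear f -> linear (fun u => e (f u) : F^o).
Proof. by move=> fP c u v; rewrite fP linearP. Qed.

Lemma lin_compf U V W (g : V -> W) (f : U -> V) :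
  linear g -> linear f -> linear (fun u => g (f u)).
Proof. by move=> gP fP c u v; rewrite fP gP. Qed.

Lemma lin_scale U V (c : F) (f : U -> V) :
  linear f -> linear (fun u => c *: f u).
Proof.
by move=> fP d u v; rewrite fP scalerDr !scalerA mulrC.
Qed.

Lemma scaleAl (A : unitalAlgType F) c (a b : A) : (c *: a) * b = c *: (a * b).
Proof. by rewrite [RHS]ualg_scaleAl. Qed.

Lemma scaleAr (A : unitalAlgType F) c (a b : A) : a * (c *: b) = c *: (a * b).
Proof. by rewrite [RHS]ualg_scaleAr. Qed.

Lemma lin_mull U (A : unitalAlgType F) (f : U -> A) (a : A) :
  linear f -> linear (fun u => f u * a).
Proof.
by move=> fP c u v; rewrite fP mulrDl; rewrite scaleAl.
Qed.

Lemma lin_mulr U (A : unitalAlgType F) (f : U -> A) (a : A) :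
  linear f -> linear (fun u => a * f u).
Proof.
by move=> fP c u v; rewrite fP mulrDr; rewrite scaleAr.
Qed.

Lemma lin_bilinl U V W X (g : V -> W -> X) (f : U -> V) w :
  is_bilinear g -> linear f -> linear (fun u => g (f u) w).
Proof. by move=> [gl _] fP c u v; rewrite fP gl. Qed.

Lemma lin_bilinr U V W X (g : V -> W -> X) (f : U -> W) v :
  is_bilinear g -> linear f -> linear (fun u => g v (f u)).
Proof. by move=> [_ gr] fP c u w; rewrite fP gr. Qed.

Lemma tensZl V W c (v : V) (w : W) : (c *: v) ⊗ w = c *: (v ⊗ w).
Proof. by rewrite -[RHS]/(tensor_scale _ _) tclassZ. Qed.

Lemma bilinear_tens V W : is_bilinear (@tens F V W).
Proof.
split=> [w c v v'|v c w w'].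
  rewrite -tensZl -[RHS]/(tensor_add _ _) tclassD.
  by apply/tclassP/trel_addl.
rewrite -tensZl -[RHS]/(tensor_add _ _) tclassD; apply/tclassP.
apply: (trel_trans (trel_addr _ _ _)).
apply: (@trel_cat _ _ _ [:: _] [:: _] [:: _] [:: _]); last exact: trel_refl.
exact/trel_sym/trel_scale.
Qed.

Lemma eq_tsum V W (X : nmodType) (t : V ⊗ W) (f g : V -> W -> X) :
  (forall v w, f v w = g v w) -> tsum t f = tsum t g.
Proof. by move=> fg; apply: eq_bigr => p _. Qed.

Lemma tsum_exch V W U X (Y : nmodType) (s : V ⊗ W) (t : U ⊗ X)
    (f : V -> W -> U -> X -> Y) :
  tsum s (fun a b => tsum t (f a b)) =
  tsum t (fun c d => tsum s (fun a b => f a b c d)).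
Proof. exact: exchange_big. Qed.

Lemma lin_tsum V W U X (t : V ⊗ W) (f : V -> W -> U -> X) :
  (forall v w, linear (f v w)) -> linear (fun u => tsum t (fun v w => f v w u)).
Proof.
move=> fP c u v; rewrite /tsum scaler_sumr -big_split /=.
by apply: eq_bigr => p _; rewrite fP.
Qed.

Lemma linZ V X (f : V -> X) c v : linear f -> f (c *: v) = c *: f v.
Proof.
move=> fP; have f0 : f 0 = 0.
  by move: (fP (-1) 0 0); rewrite scaler0 addr0 scaleN1r addNr.
by move: (fP c v 0); rewrite f0 !addr0.
Qed.

Lemma linear_tsumE V W X Y (g : X -> Y) (t : V ⊗ W) (f : V -> W -> X) :
  linear g -> g (tsum t f) = tsum t (fun v w => g (f v w)).
Proof.
move=> gP; apply: (big_morph g) => [x y|].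
  by move: (gP 1 x y); rewrite !scale1r.
by move: (linZ 0 0 gP); rewrite !scale0r.
Qed.

(** [tsum] reads off a chosen representative; bilinearity makes that choice immaterial, so any
    formal sum of pairs may replace it. *)
Lemma tsum_seq V W X (f : V -> W -> X) (s : seq (V * W)) :
  is_bilinear f -> tsum (tclass s) f = \sum_(p <- s) f p.1 p.2.
Proof.
move=> [fl fr].
have Dl w : {morph f^~ w : v v' / v + v'}.
  by move=> v v'; move: (fl w 1 v v'); rewrite !scale1r.
have Dr v : {morph f v : w w' / w + w'}.
  by move=> w w'; move: (fr v 1 w w'); rewrite !scale1r.
by rewrite tensorE tsumE // => c v w; rewrite (linZ c v (fl w)) (linZ c w (fr v)).
Qed.

Lemma tsum_tens V W X (f : V -> W -> X) v w :
  is_bilinear f -> tsum (v ⊗ w) f = f v w.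
Proof. by move=> fB; rewrite tsum_seq // big_seq1. Qed.

Lemma tsum_linear V W X (f : V -> W -> X) :
  is_bilinear f -> linear (fun t => tsum t f).
Proof.
move=> fB c s t; elim/tensor_ind: s => s; elim/tensor_ind: t => t.
rewrite -[_ + _]/(tensor_add (tensor_scale _ _) _) tclassZ tclassD !tsum_seq //.
rewrite big_cat /= big_map /= scaler_sumr; congr (_ + _); apply: eq_bigr => p _.
by rewrite (linZ c p.1 (fB.1 p.2)).
Qed.

(** This turns an axiom equating two tensors into an identity of iterated Sweedler sums of an
    arbitrary multilinear map. *)
Lemma tsum_tsum V W X U Y (f : V -> W -> X) (t : U ⊗ Y) (g : U -> Y -> V ⊗ W) :
  is_bilinear f -> tsum (tsum t g) f = tsum t (fun u y => tsum (g u y) f).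
Proof. by move=> /tsum_linear/linear_tsumE; apply. Qed.

Lemma lin_tsuml V W X U (f : V -> W -> X) (g : U -> V ⊗ W) :
  is_bilinear f -> linear g -> linear (fun u => tsum (g u) f).
Proof. by move=> fB gP c u v; rewrite gP tsum_linear. Qed.

Lemma lin_inv_map V U (f : V -> V) (g : U -> V) :
  bijective f -> linear f -> linear g -> linear (fun u => inv_map f (g u)).
Proof.
move=> fb fP gP c u v; have [fK Kf] := inv_mapK fb.
by apply: (bij_inj fb); rewrite fP !Kf gP.
Qed.

Definition trilinear U V W X (f : U -> V -> W -> X) :=
  [/\ forall v w, linear (fun u => f u v w), forall u w, linear (fun v => f u v w)
    & forall u v, linear (f u v)].

Lemma lin_tri1 U V W X Y (f : U -> V -> W -> X) (g : Y -> U) v w :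
  trilinear f -> linear g -> linear (fun y => f (g y) v w).
Proof. by case=> fP _ _ gP c y z; rewrite gP fP. Qed.

Lemma lin_tri2 U V W X Y (f : U -> V -> W -> X) (g : Y -> V) u w :
  trilinear f -> linear g -> linear (fun y => f u (g y) w).
Proof. by case=> _ fP _ gP c y z; rewrite gP fP. Qed.

Lemma lin_tri3 U V W X Y (f : U -> V -> W -> X) (g : Y -> W) u v :
  trilinear f -> linear g -> linear (fun y => f u v (g y)).
Proof. by case=> _ _ fP gP c y z; rewrite gP fP. Qed.

Lemma tsum_scaler V W X (t : V ⊗ W) (f : V -> W -> X) c :
  c *: tsum t f = tsum t (fun v w => c *: f v w).
Proof. exact: scaler_sumr. Qed.

Lemma tsum_mull V W (A : unitalAlgType F) (t : V ⊗ W) (f : V -> W -> A) a :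
  tsum t f * a = tsum t (fun v w => f v w * a).
Proof. exact: mulr_suml. Qed.

Lemma tsum_mulr V W (A : unitalAlgType F) (t : V ⊗ W) (f : V -> W -> A) a :
  a * tsum t f = tsum t (fun v w => a * f v w).
Proof. exact: mulr_sumr. Qed.

End Linear.

(* A metavariable such as [?a] cannot depend on the bound [x], so each clause
   selects the unique argument in which [x] occurs. *)
Ltac lin :=
  intros; cbn beta;
  lazymatch goal with
  | |- is_bilinear _ => split; lin
  | |- trilinear _ => split; lin
  | |- GRing.linear_for _ _ =>
    match goal with
    | |- GRing.linear_for _ (fun x => x) => apply: lin_id
    | |- GRing.linear_for _ (fun x => tsum (@?g x) ?f) =>
        apply: (@lin_tsuml _ _ _ _ _ f); lin
    | |- GRing.linear_for _ (fun x => tsum ?t (fun a b => _)) => apply: lin_tsum; lin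
    | |- GRing.linear_for _ (fun x => tens (@?f x) ?a) =>
        apply: (lin_bilinl (g := @tens _ _ _)); [exact: bilinear_tens | lin]
    | |- GRing.linear_for _ (fun x => tens ?a (@?f x)) =>
        apply: (lin_bilinr (g := @tens _ _ _)); [exact: bilinear_tens | lin]
    | |- GRing.linear_for _ (fun x => GRing.mul (@?f x) ?a) => apply: lin_mull; lin
    | |- GRing.linear_for _ (fun x => GRing.mul ?a (@?f x)) => apply: lin_mulr; lin
    | |- GRing.linear_for _ (fun x => kact (@?f x) ?a) =>
        apply: (lin_bilinl (g := @kact _ _ _)); [exact: kact_bilinear | lin]
    | |- GRing.linear_for _ (fun x => kact ?a (@?f x)) =>
        apply: (lin_bilinr (g := @kact _ _ _)); [exact: kact_bilinear | lin]
    | |- GRing.linear_for _ (fun x => GRing.scale (GRing.Linear.sort ?e (@?f x)) ?w) =>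
        apply: (@lin_scal _ _ _ _ e); lin
    | |- GRing.linear_for _ (fun x => GRing.scale ?c (@?f x)) => apply: lin_scale; lin
    | |- GRing.linear_for _ (fun x => GRing.Linear.sort ?g (@?f x)) =>
        apply: (@lin_comp _ _ _ _ g); lin
    | |- GRing.linear_for _ (fun x => GRing.Linear.sort ?g (@?f x)) =>
        apply: (@lin_form _ _ _ g); lin
    | H : GRing.linear_for _ ?F |- GRing.linear_for _ (fun x => ?F (@?f x)) =>
        apply: (lin_compf (g := F)); [exact: H | lin]
    | |- GRing.linear_for _ (fun x => inv_map ?g (@?f x)) =>
        apply: (lin_inv_map (f := g)); [by eauto with core | exact: linearP | lin]
    | H : is_bilinear ?F |- GRing.linear_for _ (fun x => ?F (@?f x) ?a) =>
        apply: (lin_bilinl (g := F)); [exact: H | lin]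
    | H : is_bilinear ?F |- GRing.linear_for _ (fun x => ?F ?a (@?f x)) =>
        apply: (lin_bilinr (g := F)); [exact: H | lin]
    | H : trilinear ?F |- GRing.linear_for _ (fun x => ?F (@?f x) ?a ?b) =>
        apply: (lin_tri1 (f := F)); [exact: H | lin]
    | H : trilinear ?F |- GRing.linear_for _ (fun x => ?F ?a (@?f x) ?b) =>
        apply: (lin_tri2 (f := F)); [exact: H | lin]
    | H : trilinear ?F |- GRing.linear_for _ (fun x => ?F ?a ?b (@?f x)) =>
        apply: (lin_tri3 (f := F)); [exact: H | lin]
    | |- GRing.linear_for ?s ?f =>
        lazymatch f with
        | (fun _ => _) => fail
        | _ => change (GRing.linear_for s (fun x => f x)); lin
        end
    end
  end.

(** * Sweedler sums in Hopf algebras *)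

Section Coalgebra.
Variables (F : fieldType) (V X : lmodType F) (D : V -> V ⊗ V) (e : V -> F).
Hypothesis DP : is_coalgebra D e.

(** Pairing [f] with its last two legs gives a bilinear map on V × (V ⊗ V), which is then applied to
    both sides of the coassociativity axiom. *)
Lemma tsum_coassoc (f : V -> V -> V -> X) v : trilinear f ->
  \tsum_(x ⊗ z <- D v) \tsum_(x' ⊗ y <- D x) f x' y z =
  \tsum_(x ⊗ y <- D v) \tsum_(y' ⊗ z <- D y) f x y' z.
Proof.
move=> fT; pose g x t := tsum t (fun y z => f x y z).
have /(congr1 (fun t => tsum t g)) := coalg_coassoc DP v.
have gB : is_bilinear g by rewrite /g; lin.
rewrite !tsum_tsum // => E; transitivity (tsum (D v) (fun x z =>
    tsum (tsum (D x) (fun x1 x2 => x1 ⊗ (x2 ⊗ z))) g)).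
  apply: eq_tsum => x z; rewrite tsum_tsum //; apply: eq_tsum => x1 x2.
  by rewrite /g !tsum_tens //; lin.
by rewrite {}E; apply: eq_tsum => x y; rewrite tsum_tens.
Qed.

Lemma tsum_counitl (f : V -> X) v : linear f ->
  \tsum_(x ⊗ y <- D v) e x *: f y = f v.
Proof.
move=> fP; rewrite -[in RHS](coalg_counitl DP v) (linear_tsumE _ _ fP).
by apply: eq_tsum => x y; rewrite linZ.
Qed.

Lemma tsum_counitr (f : V -> X) v : linear f ->
  \tsum_(x ⊗ y <- D v) e y *: f x = f v.
Proof.
move=> fP; rewrite -[in RHS](coalg_counitr DP v) (linear_tsumE _ _ fP).
by apply: eq_tsum => x y; rewrite linZ.
Qed.

End Coalgebra.

(** E(v) = E(v_1) e(v_2) = e(E(v_1) v_2) = e(v). It identifies the complex conjugate of a counit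
    composed with the star. *)
Lemma counit_unique (F : fieldType) (V : lmodType F) (D : V -> V ⊗ V)
    (e : {scalar V}) (E : V -> F^o) : is_coalgebra D e -> linear E ->
  (forall v, \tsum_(x ⊗ y <- D v) E x *: y = v) -> E =1 e.
Proof.
move=> DP EP DE v; rewrite -(tsum_counitr DP v EP) -[in RHS](DE v).
rewrite (linear_tsumE (g := e : V -> F^o)); last by exact: linearP.
by apply: eq_tsum => x y; rewrite linearZ /= /GRing.scale /= mulrC.
Qed.

(** * Antilinear involutions *)

Section Star.
Variables (R : realType) (V W X : lmodType R[i]) (st : V -> V).
Hypothesis stP : is_star st.

Lemma starK : involutive st. Proof. exact: stP.2. Qed.

Lemma star_lin c x y : st (c *: x + y) = (c^*)%C *: st x + st y.
Proof. exact: (stP.1 c x y). Qed.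

Lemma star0 : st 0 = 0.
Proof.
have := star_lin 1 0 0; rewrite conjc1 !scale1r addr0 => E.
by apply: (addrI (st 0)); rewrite -E addr0.
Qed.

Lemma starD : {morph st : x y / x + y}.
Proof. by move=> x y; have := star_lin 1 x y; rewrite conjc1 !scale1r. Qed.

Lemma starZ c x : st (c *: x) = (c^*)%C *: st x.
Proof. by move: (star_lin c x 0); rewrite star0 !addr0. Qed.

Lemma star_tsum (t : W ⊗ X) (f : W -> X -> V) :
  st (tsum t f) = tsum t (fun w x => st (f w x)).
Proof. exact: (big_morph st starD star0). Qed.

End Star.

(** The two complex conjugations of the scalar cancel. *)
Lemma star_conj_linear (R : realType) (V W : lmodType R[i]) (s : V -> V)
    (t : W -> W) (f : V -> W) : is_star s -> is_star t -> linear f ->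
  linear (fun v => t (f (s v))).
Proof.
move=> sP tP fP c u v; rewrite (star_lin sP) fP (star_lin tP).
by rewrite conjcK.
Qed.

Lemma star_alg1 (R : realType) (A : unitalAlgType R[i]) (st : A -> A) :
  is_star_alg st -> st 1 = 1.
Proof.
by move=> [[_ stK] stM]; rewrite -[LHS]mul1r -{1}[1]stK -stM mul1r stK.
Qed.


Lemma tsum_tmul (F : fieldType) (A B : unitalAlgType F) (X : lmodType F)
    (s t : A ⊗ B) (f : A -> B -> X) : is_bilinear f ->
  tsum (tmul s t) f =
  \tsum_(a ⊗ b <- s) \tsum_(a' ⊗ b' <- t) f (a * a') (b * b').
Proof.
move=> fB; rewrite /tmul tsum_tsum //; apply: eq_tsum => a b.
by rewrite tsum_tsum //; apply: eq_tsum => a' b'; rewrite tsum_tens.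
Qed.

Section Hopf.
Variables (R : realType) (K : hopfAlgebra R).
Implicit Types (k h : K) (X : lmodType R[i]).

Definition coassoc X := @tsum_coassoc _ _ X _ _ (hopf_coalg K).
Definition counitl X := @tsum_counitl _ _ X _ _ (hopf_coalg K).
Definition counitr X := @tsum_counitr _ _ X _ _ (hopf_coalg K).

Lemma tsum_antipode_r X (f : K -> X) k : linear f ->
  \tsum_(a ⊗ b <- Delta k) f (a * antipode b) = eps k *: f 1.
Proof. by move=> fP; rewrite -(linear_tsumE _ _ fP) antipode_r linZ. Qed.

Lemma tsum_antipode_l X (f : K -> X) k : linear f ->
  \tsum_(a ⊗ b <- Delta k) f (antipode a * b) = eps k *: f 1.
Proof. by move=> fP; rewrite -(linear_tsumE _ _ fP) antipode_l linZ. Qed.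

Lemma tsum_DeltaM X (f : K -> K -> X) k h : is_bilinear f ->
  \tsum_(a ⊗ b <- Delta (k * h)) f a b =
  \tsum_(a ⊗ b <- Delta k) \tsum_(a' ⊗ b' <- Delta h) f (a * a') (b * b').
Proof. by move=> fB; rewrite DeltaM tsum_tmul. Qed.

(** The left-hand side is [f] applied to Delta(S(k_1) k_2), by multiplicativity of Delta. *)
Lemma antipode_Delta_cancel X (f : K -> K -> X) k : is_bilinear f ->
  \tsum_(h ⊗ l <- Delta k) \tsum_(a ⊗ b <- Delta (antipode h))
    \tsum_(c ⊗ d <- Delta l) f (a * c) (b * d) = eps k *: f 1 1.
Proof.
move=> fB; pose g x := tsum (Delta x) f.
have gP : linear g by rewrite /g; lin.
transitivity (\tsum_(h ⊗ l <- Delta k) g (antipode h * l)).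
  by apply: eq_tsum => h l; rewrite /g tsum_DeltaM.
by rewrite tsum_antipode_l // /g Delta1 tsum_tens.
Qed.

(* The leg S(k_1)_1 k_2 ⊗ S(k_1)_2 k_3 of Delta(S(k_1) k_2) loses k_3 after right
   multiplication by S(k_4), and then k_2 by S(k_3): no convolution algebra with
   values in K ⊗ K is needed. *)
Lemma antipode_Delta_half X (f : K -> K -> X) k : is_bilinear f ->
  \tsum_(h ⊗ l <- Delta k) \tsum_(a ⊗ b <- Delta (antipode h)) f (a * l) b =
  f 1 (antipode k).
Proof.
move=> fB; rewrite -(counitl (f := fun k => f 1 (antipode k))); last by lin.
transitivity (\tsum_(h ⊗ l <- Delta k) \tsum_(h1 ⊗ h2 <- Delta h)
    \tsum_(a ⊗ b <- Delta (antipode h1)) \tsum_(c ⊗ d <- Delta h2)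
      f (a * c) (b * (d * antipode l))); last first.
  apply: eq_tsum => h l.
  rewrite -[1 in RHS]mul1r -[antipode l in RHS]mul1r.
  rewrite -(antipode_Delta_cancel (f := fun x y => f (1 * x) (y * antipode l)));
    last by lin.
  do 3![apply: eq_tsum => ? ?]; by rewrite mul1r mulrA.
rewrite coassoc; last by lin.
apply: eq_tsum => h l; rewrite (tsum_exch (Delta l)).
apply: eq_tsum => a b; rewrite coassoc; last by lin.
rewrite -(counitr (f := fun l => f (a * l) b)); last by lin.
apply: eq_tsum => c d; rewrite (tsum_antipode_r (f := fun x => f (a * c) (b * x))).
  by rewrite mulr1.
by lin.
Qed.

Lemma tsum_Delta_antipode X (f : K -> K -> X) k : is_bilinear f ->
  \tsum_(a ⊗ b <- Delta (antipode k)) f a b =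
  \tsum_(a ⊗ b <- Delta k) f (antipode b) (antipode a).
Proof.
move=> fB.
(* The tensor S(k_1)_1 k_2 S(k_3) ⊗ S(k_1)_2 is evaluated in two ways: k_2 is absorbed by S(k_1)
   through [antipode_Delta_half], or by S(k_3) through the antipode axiom. *)
transitivity (\tsum_(h ⊗ l <- Delta k) \tsum_(h1 ⊗ h2 <- Delta h)
    \tsum_(a ⊗ b <- Delta (antipode h1)) f (a * (h2 * antipode l)) b); last first.
  apply: eq_tsum => h l; rewrite -[antipode l in RHS]mul1r.
  rewrite -(antipode_Delta_half (f := fun x y => f (x * antipode l) y)); last by lin.
  by do 2![apply: eq_tsum => ? ?]; rewrite mulrA.
rewrite coassoc; last by lin.
rewrite -(counitr (f := fun k => tsum (Delta (antipode k)) f)); last by lin.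
apply: eq_tsum => h l; rewrite tsum_exch.
rewrite tsum_scaler.
apply: eq_tsum => a b.
rewrite (tsum_antipode_r (f := fun x => f (a * x) b)) ?mulr1 //.
by lin.
Qed.

Lemma eps_antipode k : eps (antipode k) = eps k.
Proof.
rewrite -(counitr (f := fun k => eps (antipode k) : R[i]^o)); last by lin.
transitivity (\tsum_(a ⊗ b <- Delta k) (eps (antipode a * b) : R[i]^o)).
  by apply: eq_tsum => a b; rewrite epsM /GRing.scale /= mulrC.
rewrite (tsum_antipode_l (f := fun x => eps x : R[i]^o)); last by lin.
by rewrite eps1 /GRing.scale /= mulr1.
Qed.

End Hopf.

(** * The R-matrix *)

Section RMatrix.
Variables (R : realType) (K : qtHopfAlgebra R).
Implicit Types (k h : K) (X : lmodType R[i]).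

Lemma tsum_rmxK X (f : K -> K -> X) : is_bilinear f ->
  \tsum_(r ⊗ s <- rmx K) \tsum_(p ⊗ q <- rmxV K) f (r * p) (s * q) = f 1 1.
Proof.
move=> fB; transitivity (tsum (tone K K) f); last by rewrite tsum_tens.
by rewrite -rmxK tsum_tmul.
Qed.

Lemma tsum_rmxVK X (f : K -> K -> X) : is_bilinear f ->
  \tsum_(p ⊗ q <- rmxV K) \tsum_(r ⊗ s <- rmx K) f (p * r) (q * s) = f 1 1.
Proof.
move=> fB; transitivity (tsum (tone K K) f); last by rewrite tsum_tens.
by rewrite -rmxVK tsum_tmul.
Qed.

Lemma tsum_rmx_Deltal X (f : K -> K -> K -> X) : trilinear f ->
  \tsum_(r ⊗ s <- rmx K) \tsum_(a ⊗ b <- Delta r) f a b s =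
  \tsum_(r ⊗ s <- rmx K) \tsum_(r' ⊗ s' <- rmx K) f r r' (s * s').
Proof.
move=> fT; pose g t c := tsum t (fun a b => f a b c).
have gB : is_bilinear g by rewrite /g; lin.
have /(congr1 (fun t => tsum t g)) := rmx_Deltal K.
rewrite !tsum_tsum // => E.
transitivity (\tsum_(r ⊗ s <- rmx K) tsum (Delta r ⊗ s) g).
  by apply: eq_tsum => r s; rewrite tsum_tens.
rewrite {}E; apply: eq_tsum => r s; rewrite tsum_tsum //.
by apply: eq_tsum => r' s'; rewrite /g !tsum_tens //; lin.
Qed.

Lemma tsum_rmx_Deltar X (f : K -> K -> K -> X) : trilinear f ->
  \tsum_(r ⊗ s <- rmx K) \tsum_(a ⊗ b <- Delta s) f r a b =
  \tsum_(r ⊗ s <- rmx K) \tsum_(r' ⊗ s' <- rmx K) f (r * r') s' s.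
Proof.
move=> fT; pose g c t := tsum t (fun a b => f c a b).
have gB : is_bilinear g by rewrite /g; lin.
have /(congr1 (fun t => tsum t g)) := rmx_Deltar K.
rewrite !tsum_tsum // => E.
transitivity (\tsum_(r ⊗ s <- rmx K) tsum (r ⊗ Delta s) g).
  by apply: eq_tsum => r s; rewrite tsum_tens.
rewrite {}E; apply: eq_tsum => r s; rewrite tsum_tsum //.
by apply: eq_tsum => r' s'; rewrite /g !tsum_tens //; lin.
Qed.

(** Apply the counit to the first leg of (Delta ⊗ id) R = R_13 R_23 and multiply by Rbar_23. The map
    [g] carries this Rbar: on R it gives [f 1], and on the expanded form it cancels R_23 and leaves
    (eps ⊗ id) R. *)
Lemma tsum_eps_rmxl X (f : K -> X) : linear f ->
  \tsum_(r ⊗ s <- rmx K) eps r *: f s = f 1.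
Proof.
move=> fP; pose h (a b : K) := eps a *: f b.
have hB : is_bilinear h by rewrite /h; lin.
pose g (a b : K) := \tsum_(p ⊗ q <- rmxV K) h (a * p) (b * q).
have gB : is_bilinear g by rewrite /g; lin.
transitivity (\tsum_(r ⊗ s <- rmx K) g r s); last first.
  by rewrite /g tsum_rmxK // /h eps1 scale1r.
transitivity (\tsum_(r ⊗ s <- rmx K) \tsum_(a ⊗ b <- Delta r) eps a *: g b s).
  rewrite (tsum_rmx_Deltal (f := fun a b c => eps a *: g b c)); last by lin.
  apply: eq_tsum => r s; rewrite -tsum_scaler; congr (_ *: _).
  pose h' (a b : K) := h a (s * b).
  have h'B : is_bilinear h' by rewrite /h'; lin.
  transitivity (h' 1 1); first by rewrite /h' /h eps1 scale1r mulr1.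
  rewrite -tsum_rmxK // /g /h'; do 2![apply: eq_tsum => ? ?]; by rewrite mulrA.
apply: eq_tsum => r s; apply: (counitl (f := fun b => g b s)); by lin.
Qed.

Lemma tsum_eps_rmxr X (f : K -> X) : linear f ->
  \tsum_(r ⊗ s <- rmx K) eps s *: f r = f 1.
Proof.
move=> fP; pose h (a b : K) := eps b *: f a.
have hB : is_bilinear h by rewrite /h; lin.
pose g (a b : K) := \tsum_(p ⊗ q <- rmxV K) h (a * p) (b * q).
have gB : is_bilinear g by rewrite /g; lin.
transitivity (\tsum_(r ⊗ s <- rmx K) g r s); last first.
  by rewrite /g tsum_rmxK // /h eps1 scale1r.
transitivity (\tsum_(r ⊗ s <- rmx K) \tsum_(a ⊗ b <- Delta s) eps b *: g r a).
  rewrite (tsum_rmx_Deltar (f := fun a b c => eps c *: g a b)); last by lin.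
  apply: eq_tsum => r s; rewrite -tsum_scaler; congr (_ *: _).
  pose h' (a b : K) := h (r * a) b.
  have h'B : is_bilinear h' by rewrite /h'; lin.
  transitivity (h' 1 1); first by rewrite /h' /h eps1 scale1r mulr1.
  rewrite -tsum_rmxK // /g /h'; do 2![apply: eq_tsum => ? ?]; by rewrite mulrA.
apply: eq_tsum => r s; apply: (counitr (f := fun b => g r b)); by lin.
Qed.

(** Apply the multiplicative map id ⊗ eps to R Rbar = 1; the factor coming from R is 1 by
    [tsum_eps_rmxr]. *)
Lemma tsum_eps_rmxVr X (f : K -> X) : linear f ->
  \tsum_(p ⊗ q <- rmxV K) eps q *: f p = f 1.
Proof.
move=> fP; pose h (a b : K) := eps b *: f a.
have hB : is_bilinear h by rewrite /h; lin.
transitivity (h 1 1); last by rewrite /h eps1 scale1r.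
rewrite -tsum_rmxK // tsum_exch; apply: eq_tsum => p q.
rewrite -[p in LHS]mul1r.
rewrite -(tsum_eps_rmxr (f := fun r => f (r * p))); last by lin.
by rewrite tsum_scaler; apply: eq_tsum => r s; rewrite /h epsM scalerA mulrC.
Qed.

Lemma tsum_eps_rmxVl X (f : K -> X) : linear f ->
  \tsum_(p ⊗ q <- rmxV K) eps p *: f q = f 1.
Proof.
move=> fP; pose h (a b : K) := eps a *: f b.
have hB : is_bilinear h by rewrite /h; lin.
transitivity (h 1 1); last by rewrite /h eps1 scale1r.
rewrite -tsum_rmxK // tsum_exch; apply: eq_tsum => p q.
rewrite -[q in LHS]mul1r.
rewrite -(tsum_eps_rmxl (f := fun r => f (r * q))); last by lin.
by rewrite tsum_scaler; apply: eq_tsum => r s; rewrite /h epsM scalerA mulrC.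
Qed.

(* Uniqueness of the inverse: (S ⊗ id)(R) R = 1 by (Delta ⊗ id) R = R13 R23. *)
Lemma tsum_antipode_rmx X (f : K -> K -> X) : is_bilinear f ->
  \tsum_(r ⊗ s <- rmx K) f (antipode r) s = \tsum_(p ⊗ q <- rmxV K) f p q.
Proof.
move=> fB.
have cancel (g : K -> K -> X) : is_bilinear g -> g 1 1 =
    \tsum_(r ⊗ s <- rmx K) \tsum_(r' ⊗ s' <- rmx K) g (antipode r * r') (s * s').
  move=> gB; rewrite -(tsum_rmx_Deltal (f := fun a b c => g (antipode a * b) c)).
    rewrite -(tsum_eps_rmxl (f := g 1)); last by lin.
    apply: eq_tsum => r s; rewrite (tsum_antipode_l (f := g^~ s)) //; by lin.
  by lin.
transitivity (\tsum_(p ⊗ q <- rmxV K) \tsum_(r ⊗ s <- rmx K)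
    \tsum_(r' ⊗ s' <- rmx K) f (antipode r * r' * p) (s * s' * q)); last first.
  apply: eq_tsum => p q; rewrite -[p in RHS]mul1r -[q in RHS]mul1r.
  by rewrite -(cancel (fun x y => f (x * p) (y * q))) //; lin.
rewrite tsum_exch; apply: eq_tsum => r s; rewrite tsum_exch.
rewrite -[antipode r in LHS]mulr1 -[s in LHS]mulr1.
rewrite -(tsum_rmxK (f := fun x y => f (antipode r * x) (s * y))); last by lin.
by do 2![apply: eq_tsum => ? ?]; rewrite !mulrA.
Qed.

(** (Delta ⊗ id) Rbar = Rbar_23 Rbar_13: substitute Rbar = (S ⊗ id) R and use that S reverses
    coproducts. *)
Lemma tsum_rmxV_Deltal X (f : K -> K -> K -> X) : trilinear f ->
  \tsum_(p ⊗ q <- rmxV K) \tsum_(a ⊗ b <- Delta p) f a b q =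
  \tsum_(p ⊗ q <- rmxV K) \tsum_(p' ⊗ q' <- rmxV K) f p p' (q' * q).
Proof.
move=> fT.
rewrite -(tsum_antipode_rmx (f := fun p q => tsum (Delta p) (fun a b => f a b q)));
  last by lin.
transitivity (\tsum_(r ⊗ s <- rmx K) \tsum_(a ⊗ b <- Delta r)
    f (antipode b) (antipode a) s).
  by apply: eq_tsum => r s; rewrite tsum_Delta_antipode //; lin.
rewrite (tsum_rmx_Deltal (f := fun a b c => f (antipode b) (antipode a) c));
  last by lin.
rewrite -(tsum_antipode_rmx (f := fun p q => tsum (rmxV K) (fun p' q' => f p p' (q' * q))));
  last by lin.
rewrite tsum_exch; apply: eq_tsum => r s.
by rewrite -(tsum_antipode_rmx (f := fun p' q' => f (antipode r) p' (q' * s)));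
  last by lin.
Qed.

(** Delta(k) Rbar = Rbar Delta^cop(k), obtained by multiplying Delta^cop(k) = R Delta(k) Rbar on the
    left by Rbar. *)
Lemma tsum_Delta_rmxV X (f : K -> K -> X) k : is_bilinear f ->
  \tsum_(a ⊗ b <- Delta k) \tsum_(p ⊗ q <- rmxV K) f (a * p) (b * q) =
  \tsum_(a ⊗ b <- Delta k) \tsum_(p ⊗ q <- rmxV K) f (p * b) (q * a).
Proof.
move=> fB.
pose g x y := \tsum_(p ⊗ q <- rmxV K) f (p * x) (q * y).
have gB : is_bilinear g by rewrite /g; lin.
transitivity (tsum (tflip (Delta k)) g); last first.
  by rewrite tsum_tsum //; apply: eq_tsum => a b; rewrite tsum_tens.
rewrite rmx_cop tsum_tmul // tsum_tmul; last by lin.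
rewrite [RHS]tsum_exch; apply: eq_tsum => a b.
rewrite [RHS]tsum_exch; apply: eq_tsum => p q.
rewrite -[a in LHS]mul1r -[b in LHS]mul1r.
rewrite -(tsum_rmxVK (f := fun x y => f (x * a * p) (y * b * q))); last by lin.
by rewrite tsum_exch; do 2![apply: eq_tsum => ? ?]; rewrite !mulrA.
Qed.

(** Rbar_12 Rbar_13 Rbar_23 = Rbar_23 Rbar_13 Rbar_12: the right side is (Delta ⊗ id)(Rbar) Rbar_12,
    and moving Rbar_12 to the left turns Delta into Delta^cop. *)
Lemma yang_baxter X (f : K -> K -> K -> X) : trilinear f ->
  \tsum_(a ⊗ b <- rmxV K) \tsum_(a' ⊗ c <- rmxV K) \tsum_(b' ⊗ c' <- rmxV K)
    f (a * a') (b * b') (c * c') =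
  \tsum_(a ⊗ b <- rmxV K) \tsum_(a' ⊗ c <- rmxV K) \tsum_(b' ⊗ c' <- rmxV K)
    f (a' * a) (b' * b) (c' * c).
Proof.
move=> fT.
transitivity (\tsum_(p ⊗ q <- rmxV K) \tsum_(x ⊗ y <- Delta p)
   \tsum_(a ⊗ b <- rmxV K) f (a * y) (b * x) q).
  rewrite (tsum_rmxV_Deltal (f := fun x y z =>
      tsum (rmxV K) (fun a b => f (a * y) (b * x) z))); last by lin.
  rewrite tsum_exch [RHS]tsum_exch; apply: eq_tsum => a' c.
  by rewrite tsum_exch.
transitivity (\tsum_(p ⊗ q <- rmxV K) \tsum_(x ⊗ y <- Delta p)
   \tsum_(a ⊗ b <- rmxV K) f (x * a) (y * b) q).
  apply: eq_tsum => p q.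
  by rewrite (tsum_Delta_rmxV (f := fun x y => f x y q)) //; lin.
rewrite (tsum_rmxV_Deltal (f := fun x y z =>
      tsum (rmxV K) (fun a b => f (x * a) (y * b) z))); last by lin.
rewrite [RHS]tsum_exch; apply: eq_tsum => a' c.
by rewrite tsum_exch.
Qed.

End RMatrix.

(** * The star, the inverse antipode and the R-matrix *)

Section StarHopf.
Variables (R : realType) (K : qtHopfStarAlgebra R).
Implicit Types (k h : K) (X : lmodType R[i]).

Let kstarS : is_star (@kstar R K) := (kstar_star K).1.

Lemma kstarK : involutive (@kstar R K). Proof. exact: starK kstarS. Qed.

Lemma kstarM k h : kstar (k * h) = kstar h * kstar k.
Proof. exact: (kstar_star K).2. Qed.

Lemma kstar1 : kstar (1 : K) = 1. Proof. exact: star_alg1 (kstar_star K). Qed.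

Lemma tsum_Delta_kstar X (f : K -> K -> X) k : is_bilinear f ->
  \tsum_(a ⊗ b <- Delta (kstar k)) f a b =
  \tsum_(a ⊗ b <- Delta k) f (kstar a) (kstar b).
Proof.
move=> fB; rewrite Delta_kstar tsum_tsum //.
by apply: eq_tsum => a b; rewrite tsum_tens.
Qed.

(** The conjugate of eps ∘ [kstar] satisfies the left counit law, so uniqueness of the counit
    applies. *)
Lemma eps_kstar k : eps (kstar k) = ((eps k)^*)%C.
Proof.
have idS : is_star (conjc : R[i]^o -> R[i]^o).
  by split; [move=> c x y; rewrite rmorphD rmorphM | exact: conjcK].
have EP : linear (fun k => ((eps (kstar k))^*)%C : R[i]^o).
  by apply: (star_conj_linear (f := eps : K -> R[i]^o) kstarS idS); exact: linearP.
rewrite -[LHS]conjcK; congr conjc.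
apply: (counit_unique (hopf_coalg K) EP) => v.
apply: (can_inj kstarK); rewrite (star_tsum kstarS).
rewrite -[RHS](coalg_counitl (hopf_coalg K)).
rewrite (tsum_Delta_kstar (f := fun x y => eps x *: y)); last by lin.
by apply: eq_tsum => x y; rewrite (starZ kstarS) conjcK.
Qed.

(* Below, [antipodeVE] identifies this map with the inverse of the antipode. *)
Let sinv k := kstar (antipode (kstar k)).

Let sinv_linear : linear sinv.
Proof. exact: star_conj_linear kstarS kstarS (linearP _). Qed.

Let sinv_l k : \tsum_(a ⊗ b <- Delta k) b * sinv a = eps k *: (1 : K).
Proof.
apply: (can_inj kstarK); rewrite (star_tsum kstarS) (starZ kstarS) kstar1.
rewrite -eps_kstar -antipode_l.
rewrite (tsum_Delta_kstar (f := fun x y => antipode x * y)); last by lin.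
by apply: eq_tsum => a b; rewrite kstarM /sinv kstarK.
Qed.

(** Under convolution, [sinv] ∘ S is a right inverse of S (apply [sinv_l] to S(l)), while the
    identity is a left inverse; the two therefore agree. *)
Let sinv_antipode k : sinv (antipode k) = k.
Proof.
have sinvP := sinv_linear.
have SE l :
    \tsum_(a ⊗ b <- Delta l) antipode a * sinv (antipode b) = eps l *: (1 : K).
  rewrite -[eps l]eps_antipode -sinv_l.
  by rewrite (tsum_Delta_antipode (f := fun x y => y * sinv x)) //; lin.
transitivity (\tsum_(a ⊗ b <- Delta k) \tsum_(c ⊗ d <- Delta b)
    a * (antipode c * sinv (antipode d))).
  rewrite -coassoc; last by lin.
  rewrite -[LHS](counitl (f := fun k => sinv (antipode k))); last by lin.
  apply: eq_tsum => a b; rewrite -[sinv (antipode b) in LHS]mul1r.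
  rewrite -(tsum_antipode_r (f := fun x => x * sinv (antipode b))); last by lin.
  by apply: eq_tsum => c d; rewrite mulrA.
rewrite -[RHS](counitr (f := fun k => k)); last by lin.
by apply: eq_tsum => a b; rewrite -tsum_mulr SE scaleAr mulr1.
Qed.

Let antipode_sinv k : antipode (sinv k) = k.
Proof. by apply: (can_inj kstarK); exact: sinv_antipode. Qed.

Lemma antipode_bij : bijective (@antipode R K).
Proof. by exists sinv. Qed.

Notation antipodeV := (inv_map (@antipode R K)).

Lemma antipodeVE k : antipodeV k = kstar (antipode (kstar k)).
Proof.
by apply: (bij_inj antipode_bij); rewrite (inv_mapK antipode_bij).2 antipode_sinv.
Qed.

Lemma antipodeV_kstar k : antipodeV (kstar k) = kstar (antipode k).
Proof. by rewrite antipodeVE kstarK. Qed.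

(* [lin] finds the bijectivity of the antipodes among the hypotheses. *)
Let S_bij : bijective (@antipode R K) := antipode_bij.

Lemma tsum_antipodeV_l X (f : K -> X) k : linear f ->
  \tsum_(a ⊗ b <- Delta k) f (b * antipodeV a) = eps k *: f 1.
Proof.
move=> fP; rewrite -(linear_tsumE _ _ fP) -linZ // -sinv_l; congr f.
by apply: eq_tsum => a b; rewrite antipodeVE.
Qed.

Lemma tsum_Delta_antipodeV X (f : K -> K -> X) k : is_bilinear f ->
  \tsum_(a ⊗ b <- Delta (antipodeV k)) f a b =
  \tsum_(a ⊗ b <- Delta k) f (antipodeV b) (antipodeV a).
Proof.
move=> fB; rewrite -[in RHS]((inv_mapK antipode_bij).2 k).
rewrite (tsum_Delta_antipode (f := fun a b => f (antipodeV b) (antipodeV a))).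
  by apply: eq_tsum => a b; rewrite !(inv_mapK antipode_bij).1.
by lin.
Qed.

(** (id ⊗ Delta) R = R_13 R_12 gives R (id ⊗ S^{-1})(R) = 1, and the inverse of R is unique. *)
Lemma tsum_antipodeV_rmx X (f : K -> K -> X) : is_bilinear f ->
  \tsum_(r ⊗ s <- rmx K) f r (antipodeV s) = \tsum_(p ⊗ q <- rmxV K) f p q.
Proof.
move=> fB.
have cancel (g : K -> K -> X) : is_bilinear g -> g 1 1 =
    \tsum_(r ⊗ s <- rmx K) \tsum_(r' ⊗ s' <- rmx K) g (r * r') (s * antipodeV s').
  move=> gB.
  rewrite -(tsum_rmx_Deltar (f := fun a b c => g a (c * antipodeV b))); last by lin.
  rewrite -(tsum_eps_rmxr (f := fun r => g r 1)); last by lin.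
  by apply: eq_tsum => r s; rewrite (tsum_antipodeV_l (f := g r)) //; lin.
transitivity (\tsum_(p ⊗ q <- rmxV K) \tsum_(r ⊗ s <- rmx K)
    \tsum_(r' ⊗ s' <- rmx K) f (p * (r * r')) (q * (s * antipodeV s'))); last first.
  apply: eq_tsum => p q; rewrite -[p in RHS]mulr1 -[q in RHS]mulr1.
  by rewrite -(cancel (fun x y => f (p * x) (q * y))) //; lin.
transitivity (\tsum_(r' ⊗ s' <- rmx K) \tsum_(p ⊗ q <- rmxV K) \tsum_(r ⊗ s <- rmx K)
    f (p * r * r') (q * s * antipodeV s')).
  apply: eq_tsum => r s; rewrite -[r in LHS]mul1r -[antipodeV s in LHS]mul1r.
  by rewrite -(tsum_rmxVK (f := fun x y => f (x * r) (y * antipodeV s))) //; lin.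
rewrite tsum_exch; apply: eq_tsum => p q; rewrite tsum_exch.
by do 2![apply: eq_tsum => ? ?]; rewrite !mulrA.
Qed.

(** Starting from Rbar = (S ⊗ id) R, applying S^{-1} to both legs leaves (id ⊗ S^{-1}) R, which is
    Rbar again. *)
Lemma tsum_antipodeV_rmxV X (f : K -> K -> X) : is_bilinear f ->
  \tsum_(p ⊗ q <- rmxV K) f (antipodeV p) (antipodeV q) = \tsum_(p ⊗ q <- rmxV K) f p q.
Proof.
move=> fB; rewrite -(tsum_antipodeV_rmx fB).
rewrite -(tsum_antipode_rmx (f := fun p q => f (antipodeV p) (antipodeV q)));
  last by lin.
by apply: eq_tsum => r s; rewrite (inv_mapK antipode_bij).1.
Qed.

Lemma tsum_rmxV_Deltar X (f : K -> K -> K -> X) : trilinear f ->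
  \tsum_(p ⊗ q <- rmxV K) \tsum_(a ⊗ b <- Delta q) f p a b =
  \tsum_(p ⊗ q <- rmxV K) \tsum_(p' ⊗ q' <- rmxV K) f (p * p') q q'.
Proof.
move=> fT.
rewrite -(tsum_antipodeV_rmx (f := fun p q => tsum (Delta q) (fun a b => f p a b)));
  last by lin.
transitivity (\tsum_(r ⊗ s <- rmx K) \tsum_(a ⊗ b <- Delta s)
    f r (antipodeV b) (antipodeV a)).
  by apply: eq_tsum => r s; rewrite tsum_Delta_antipodeV //; lin.
rewrite (tsum_rmx_Deltar (f := fun a b c => f a (antipodeV c) (antipodeV b)));
  last by lin.
rewrite -(tsum_antipodeV_rmx (f := fun p q => tsum (rmxV K) (fun p' q' => f (p * p') q q')));
  last by lin.
apply: eq_tsum => r s.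
by rewrite -(tsum_antipodeV_rmx (f := fun p' q' => f (r * p') (antipodeV s) q')) //; lin.
Qed.

End StarHopf.

(** * The braided antipode *)

Lemma tsum_kact_mul (R : realType) (K : hopfAlgebra R) (A : moduleAlgebra K)
    (X : lmodType R[i]) (f : A -> X) (k : K) (a b : A) : linear f ->
  \tsum_(h ⊗ l <- Delta k) f ((h ▹ a) * (l ▹ b)) = f (k ▹ (a * b)).
Proof. by move=> fP; rewrite kact_mul (linear_tsumE _ _ fP). Qed.

Section BraidedHopf.
Variables (R : realType) (K : qtHopfAlgebra R) (L : braidedHopfAlgebra K).
Implicit Types (k : K) (x y : L) (X : lmodType R[i]).

Definition bcoassoc X := @tsum_coassoc _ _ X _ _ (bh_coalg L).
Definition bcounitl X := @tsum_counitl _ _ X _ _ (bh_coalg L).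
Definition bcounitr X := @tsum_counitr _ _ X _ _ (bh_coalg L).

Lemma tsum_bantipode_r X (f : L -> X) x : linear f ->
  \tsum_(a ⊗ b <- bDelta x) f (a * bantipode b) = beps x *: f 1.
Proof. by move=> fP; rewrite -(linear_tsumE _ _ fP) bantipode_r linZ. Qed.

Lemma tsum_bantipode_l X (f : L -> X) x : linear f ->
  \tsum_(a ⊗ b <- bDelta x) f (bantipode a * b) = beps x *: f 1.
Proof. by move=> fP; rewrite -(linear_tsumE _ _ fP) bantipode_l linZ. Qed.

Lemma beps_bantipode x : beps (bantipode x) = beps x.
Proof.
rewrite -(bcounitr (f := fun x => beps (bantipode x) : R[i]^o)); last by lin.
transitivity (\tsum_(a ⊗ b <- bDelta x) (beps (bantipode a * b) : R[i]^o)).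
  by apply: eq_tsum => a b; rewrite bepsM /GRing.scale /= mulrC.
rewrite (tsum_bantipode_l (f := fun x => beps x : R[i]^o)); last by lin.
by rewrite beps1 /GRing.scale /= mulr1.
Qed.

Lemma bantipode1 : bantipode (1 : L) = 1.
Proof.
have := bantipode_l (1 : L); rewrite bDelta1 beps1 scale1r tsum_tens.
  by rewrite mulr1.
by lin.
Qed.

Lemma tsum_bDeltaM X (f : L -> L -> X) x y : is_bilinear f ->
  \tsum_(a ⊗ b <- bDelta (x * y)) f a b =
  \tsum_(a ⊗ b <- bDelta x) \tsum_(c ⊗ d <- bDelta y) \tsum_(r ⊗ s <- rmx K)
    f (a * (s ▹ c)) ((r ▹ b) * d).
Proof.
move=> fB; rewrite bDeltaM /bmul tsum_tsum //; apply: eq_tsum => a b.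
rewrite tsum_tsum //; apply: eq_tsum => c d.
by rewrite tsum_tsum //; apply: eq_tsum => r s; rewrite tsum_tens.
Qed.

Lemma tsum_bDelta_kact X (f : L -> L -> X) k x : is_bilinear f ->
  \tsum_(a ⊗ b <- bDelta (k ▹ x)) f a b =
  \tsum_(a ⊗ b <- bDelta x) \tsum_(h ⊗ l <- Delta k) f (h ▹ a) (l ▹ b).
Proof.
move=> fB; rewrite bDelta_kact /bact tsum_tsum //; apply: eq_tsum => a b.
by rewrite tsum_tsum //; apply: eq_tsum => h l; rewrite tsum_tens.
Qed.

(* The braided antipode identity for xy is solved for S_L(xy) in two steps,
   cancelling the factor y_2 here and the factor x_2 in [bantipodeM]. *)
Lemma bantipodeM_half x y :
  \tsum_(a ⊗ b <- bDelta x) \tsum_(r ⊗ s <- rmx K)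
    bantipode (a * (s ▹ y)) * (r ▹ b) = beps x *: bantipode y.
Proof.
rewrite -[in RHS](bcounitl (f := fun y => beps x *: bantipode y)); last by lin.
transitivity (\tsum_(c ⊗ e <- bDelta y) \tsum_(c' ⊗ d <- bDelta c)
    \tsum_(a ⊗ b <- bDelta x) \tsum_(r ⊗ s <- rmx K)
      bantipode (a * (s ▹ c')) * ((r ▹ b) * (d * bantipode e))); last first.
  apply: eq_tsum => c e; rewrite scalerA mulrC -bepsM -[bantipode e in RHS]mul1r.
  rewrite -(tsum_bantipode_l (f := fun z => z * bantipode e)); last by lin.
  rewrite (tsum_bDeltaM (f := fun u v => bantipode u * v * bantipode e)); last by lin.
  rewrite tsum_exch; do 3![apply: eq_tsum => ? ?]; by rewrite !mulrA.
rewrite bcoassoc; last by lin.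
rewrite -[LHS](bcounitr (f := fun y => \tsum_(a ⊗ b <- bDelta x)
  \tsum_(r ⊗ s <- rmx K) bantipode (a * (s ▹ y)) * (r ▹ b))); last by lin.
apply: eq_tsum => c e; rewrite [RHS]tsum_exch tsum_scaler.
apply: eq_tsum => a b; rewrite [RHS]tsum_exch tsum_scaler; apply: eq_tsum => r s.
rewrite (tsum_bantipode_r (f := fun z => bantipode (a * (s ▹ c)) * ((r ▹ b) * z))).
  by rewrite mulr1.
by lin.
Qed.

Lemma bantipodeM x y :
  bantipode (x * y) =
  \tsum_(r ⊗ s <- rmx K) (s ▹ bantipode y) * (r ▹ bantipode x).
Proof.
(* The middle term is read in two ways. Pairing [a] with [b'] allows [bantipodeM_half]; pairing [b']
   with [c] lets (Delta ⊗ id) R = R_13 R_23 merge the two R-matrices into one acting on b' S_L(c),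
   which collapses to a counit. *)
transitivity (\tsum_(a ⊗ b <- bDelta x) \tsum_(b' ⊗ c <- bDelta b)
    \tsum_(r ⊗ s <- rmx K) \tsum_(r' ⊗ s' <- rmx K)
      bantipode (a * ((s * s') ▹ y)) * ((r ▹ b') * (r' ▹ bantipode c))); last first.
  rewrite -bcoassoc; last by lin.
  symmetry; transitivity (\tsum_(a ⊗ c <- bDelta x) \tsum_(r ⊗ s <- rmx K)
      (beps a *: bantipode (s ▹ y)) * (r ▹ bantipode c)).
    rewrite [RHS]tsum_exch; apply: eq_tsum => r s.
    rewrite -(bcounitl (f := fun c => (s ▹ bantipode y) * (r ▹ bantipode c))).
      by apply: eq_tsum => a c; rewrite scaleAl bantipode_kact.
    by lin.
  apply: eq_tsum => a c.
  transitivity (\tsum_(r' ⊗ s' <- rmx K) \tsum_(a1 ⊗ a2 <- bDelta a)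
      \tsum_(r ⊗ s <- rmx K)
      bantipode (a1 * (s ▹ s' ▹ y)) * (r ▹ a2) * (r' ▹ bantipode c)).
    apply: eq_tsum => r' s'; rewrite -bantipodeM_half tsum_mull.
    by apply: eq_tsum => a1 a2; rewrite tsum_mull.
  rewrite [LHS]tsum_exch; apply: eq_tsum => a1 a2.
  by rewrite [LHS]tsum_exch; do 2![apply: eq_tsum => ? ?]; rewrite kactM mulrA.
rewrite -[LHS](bcounitr (f := fun x => bantipode (x * y))); last by lin.
apply: eq_tsum => a b.
transitivity (\tsum_(b' ⊗ c <- bDelta b) \tsum_(r ⊗ s <- rmx K)
    bantipode (a * (s ▹ y)) * (r ▹ (b' * bantipode c))); last first.
  apply: eq_tsum => b' c.
  rewrite -(tsum_rmx_Deltal (f := fun k h l =>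
     bantipode (a * (l ▹ y)) * ((k ▹ b') * (h ▹ bantipode c)))); last by lin.
  apply: eq_tsum => r s.
  by rewrite (tsum_kact_mul (f := fun z => bantipode (a * (s ▹ y)) * z)) //; lin.
rewrite tsum_exch -[y in LHS]kact1.
rewrite -(tsum_eps_rmxl (f := fun k => bantipode (a * (k ▹ y)))); last by lin.
rewrite tsum_scaler; apply: eq_tsum => r s.
rewrite (tsum_bantipode_r (f := fun z => bantipode (a * (s ▹ y)) * (r ▹ z))).
  by rewrite kact_unit scaleAr mulr1.
by lin.
Qed.

Lemma bantipode_bDelta_cancel X (f : L -> L -> X) x : is_bilinear f ->
  \tsum_(y ⊗ z <- bDelta x) \tsum_(a ⊗ b <- bDelta (bantipode y))
    \tsum_(c ⊗ d <- bDelta z) \tsum_(r ⊗ s <- rmx K)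
      f (a * (s ▹ c)) ((r ▹ b) * d) = beps x *: f 1 1.
Proof.
move=> fB; pose g x := tsum (bDelta x) f.
have gP : linear g by rewrite /g; lin.
transitivity (\tsum_(y ⊗ z <- bDelta x) g (bantipode y * z)).
  by apply: eq_tsum => y z; rewrite /g tsum_bDeltaM.
by rewrite tsum_bantipode_l // /g bDelta1 tsum_tens.
Qed.

(** Braided form of [antipode_Delta_half]: the second leg of Delta_L(S_L(x_1) x_2) is multiplied on
    the right by S_L of the next leg, which removes its last factor. *)
Lemma bantipode_bDelta_half X (f : L -> L -> X) x : is_bilinear f ->
  \tsum_(y ⊗ z <- bDelta x) \tsum_(a ⊗ b <- bDelta (bantipode y))
    \tsum_(r ⊗ s <- rmx K) f (a * (s ▹ z)) (r ▹ b) = f 1 (bantipode x).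
Proof.
move=> fB; rewrite -(bcounitl (f := fun x => f 1 (bantipode x))); last by lin.
transitivity (\tsum_(y ⊗ e <- bDelta x) \tsum_(y' ⊗ z <- bDelta y)
    \tsum_(a ⊗ b <- bDelta (bantipode y')) \tsum_(c ⊗ d <- bDelta z)
      \tsum_(r ⊗ s <- rmx K)
      f (a * (s ▹ c)) ((r ▹ b) * (d * bantipode e))); last first.
  apply: eq_tsum => y e; rewrite -[bantipode e in RHS]mul1r.
  rewrite -(bantipode_bDelta_cancel (f := fun u v => f u (v * bantipode e)));
    last by lin.
  by do 4![apply: eq_tsum => ? ?]; rewrite mulrA.
rewrite bcoassoc; last by lin.
apply: eq_tsum => y z; rewrite (tsum_exch (bDelta z)).
apply: eq_tsum => a b; rewrite bcoassoc; last by lin.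
rewrite -(bcounitr (f := fun z => \tsum_(r ⊗ s <- rmx K) f (a * (s ▹ z)) (r ▹ b)));
  last by lin.
apply: eq_tsum => c d; rewrite tsum_exch tsum_scaler; apply: eq_tsum => r s.
rewrite (tsum_bantipode_r (f := fun v => f (a * (s ▹ c)) ((r ▹ b) * v))).
  by rewrite mulr1.
by lin.
Qed.

Lemma tsum_bDelta_bantipode X (f : L -> L -> X) x : is_bilinear f ->
  \tsum_(a ⊗ b <- bDelta (bantipode x)) f a b =
  \tsum_(a ⊗ b <- bDelta x) \tsum_(r ⊗ s <- rmx K)
    f (s ▹ bantipode b) (r ▹ bantipode a).
Proof.
move=> fB.
(* As in [tsum_Delta_antipode], the leg [z] is absorbed either by S_L(y') or by S_L(e). In the
   second case (id ⊗ Delta) R = R_13 R_12 first merges the two R-matrices into one acting on the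
   product. *)
transitivity (\tsum_(y ⊗ e <- bDelta x) \tsum_(y' ⊗ z <- bDelta y)
    \tsum_(a ⊗ b <- bDelta (bantipode y')) \tsum_(r ⊗ s <- rmx K)
      \tsum_(r' ⊗ s' <- rmx K)
      f (a * ((s' ▹ z) * (s ▹ bantipode e))) ((r * r') ▹ b)); last first.
  apply: eq_tsum => y e; rewrite [RHS](_ : _ =
    \tsum_(r ⊗ s <- rmx K) f (1 * (s ▹ bantipode e)) (r ▹ bantipode y)); last first.
    by apply: eq_tsum => r s; rewrite mul1r.
  transitivity (\tsum_(r ⊗ s <- rmx K) \tsum_(y' ⊗ z <- bDelta y)
    \tsum_(a ⊗ b <- bDelta (bantipode y'))
      \tsum_(r' ⊗ s' <- rmx K)
      f (a * (s' ▹ z) * (s ▹ bantipode e)) (r ▹ r' ▹ b)).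
    rewrite [RHS]tsum_exch; apply: eq_tsum => y' z.
    rewrite [RHS]tsum_exch; do 3![apply: eq_tsum => ? ?].
    by rewrite kactM mulrA.
  apply: eq_tsum => r s.
  by rewrite (bantipode_bDelta_half (f := fun u v => f (u * (s ▹ bantipode e)) (r ▹ v))) //; lin.
rewrite bcoassoc; last by lin.
rewrite -[LHS](bcounitr (f := fun x => tsum (bDelta (bantipode x)) f)); last by lin.
apply: eq_tsum => y z; rewrite tsum_exch tsum_scaler; apply: eq_tsum => a b.
transitivity (\tsum_(c ⊗ d <- bDelta z) \tsum_(r ⊗ s <- rmx K)
    f (a * (s ▹ (c * bantipode d))) (r ▹ b)); last first.
  apply: eq_tsum => c d.
  rewrite -(tsum_rmx_Deltar (f := fun k h l =>
     f (a * ((h ▹ c) * (l ▹ bantipode d))) (k ▹ b))); last by lin.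
  apply: eq_tsum => r s.
  by rewrite (tsum_kact_mul (f := fun u => f (a * u) (r ▹ b))) //; lin.
rewrite tsum_exch -[b in LHS]kact1.
rewrite -(tsum_eps_rmxr (f := fun k => f a (k ▹ b))); last by lin.
rewrite tsum_scaler; apply: eq_tsum => r s.
rewrite (tsum_bantipode_r (f := fun u => f (a * (s ▹ u)) (r ▹ b))).
  by rewrite kact_unit scaleAr mulr1 (linZ _ _ (fB.1 _)).
by lin.
Qed.

End BraidedHopf.

(** * The braided antipode combined with the star *)

Lemma mstar_kact (R : realType) (K : qtHopfStarAlgebra R) (A : moduleAlgebra K)
    (st : A -> A) k a : is_module_star st -> st (k ▹ a) = kstar (antipode k) ▹ st a.
Proof. by move=> stP; rewrite stP.2 antipodeV_kstar. Qed.

Section BraidedStar.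
Variables (R : realType) (K : qtHopfStarAlgebra R) (L : braidedHopfStarAlgebra K).
Implicit Types (k : K) (x y : L) (X : lmodType R[i]).

Notation bantipodeV := (inv_map (@bantipode R K L)).

(** This is the L-leg of [compat_rhs]. It obeys the same K-rule as [mstar], and its coproduct law,
    unlike that of [bstar], contains no R-matrix. *)
Definition costar x : L := bantipodeV (bstar x).

Let SL_bij : bijective (@bantipode R K L) := bantipode_bij L.
Let bstarS : is_star (@bstar R K L) := (bstar_star L).1.1.

Lemma bantipodeK : cancel (@bantipode R K L) bantipodeV.
Proof. exact: (inv_mapK SL_bij).1. Qed.

Lemma bantipodeVK : cancel bantipodeV (@bantipode R K L).
Proof. exact: (inv_mapK SL_bij).2. Qed.

Lemma bantipodeV_kact k x : bantipodeV (k ▹ x) = k ▹ bantipodeV x.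
Proof. by apply: (can_inj bantipodeK); rewrite bantipode_kact !bantipodeVK. Qed.

(** Write x = S_L(z) and expand Delta_L(S_L(z)) by [tsum_bDelta_bantipode]; the R produced there is
    cancelled by Rbar. *)
Lemma tsum_bDelta_bantipodeV X (f : L -> L -> X) x : is_bilinear f ->
  \tsum_(a ⊗ b <- bDelta (bantipodeV x)) f a b =
  \tsum_(a ⊗ b <- bDelta x) \tsum_(p ⊗ q <- rmxV K)
    f (p ▹ bantipodeV b) (q ▹ bantipodeV a).
Proof.
move=> fB; rewrite -{2}[x]bantipodeVK; set z := bantipodeV x.
rewrite (tsum_bDelta_bantipode (f := fun a b => \tsum_(p ⊗ q <- rmxV K)
    f (p ▹ bantipodeV b) (q ▹ bantipodeV a))); last by lin.
apply: eq_tsum => a b; rewrite [RHS]tsum_exch.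
rewrite -[a in LHS]kact1 -[b in LHS]kact1.
rewrite -(tsum_rmxVK (f := fun k l => f (k ▹ a) (l ▹ b))); last by lin.
do 2![apply: eq_tsum => ? ?].
by rewrite !bantipodeV_kact !bantipodeK !kactM.
Qed.

Lemma bantipodeVM x y :
  bantipodeV (x * y) =
  \tsum_(p ⊗ q <- rmxV K) (p ▹ bantipodeV y) * (q ▹ bantipodeV x).
Proof.
apply: (can_inj bantipodeK); rewrite bantipodeVK.
rewrite (linear_tsumE (g := @bantipode R K L)); last by exact: linearP.
rewrite -[x in LHS]kact1 -[y in LHS]kact1.
rewrite -(tsum_rmxK (f := fun k l => (l ▹ x) * (k ▹ y))); last by lin.
rewrite tsum_exch; apply: eq_tsum => p q; rewrite bantipodeM.
by apply: eq_tsum => r s; rewrite !bantipode_kact !bantipodeVK !kactM.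
Qed.

Lemma tsum_bDelta_bstar X (f : L -> L -> X) x : is_bilinear f ->
  \tsum_(a ⊗ b <- bDelta (bstar x)) f a b =
  \tsum_(a ⊗ b <- bDelta x) \tsum_(r ⊗ s <- rmx K)
    f (s ▹ bstar a) (r ▹ bstar b).
Proof.
move=> fB; rewrite bDelta_bstar /btensor_star tsum_tsum //.
apply: eq_tsum => a b; rewrite tsum_tsum //.
by apply: eq_tsum => r s; rewrite tsum_tens.
Qed.

(** Uniqueness of the counit as in [eps_kstar]; the R in the coproduct of a starred element
    disappears by (id ⊗ eps) R = 1. *)
Lemma beps_bstar x : beps (bstar x) = ((beps x)^*)%C.
Proof.
have idS : is_star (conjc : R[i]^o -> R[i]^o).
  by split; [move=> c y z; rewrite rmorphD rmorphM | exact: conjcK].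
have EP : linear (fun x => ((beps (bstar x))^*)%C : R[i]^o).
  by apply: (star_conj_linear (f := beps : L -> R[i]^o) bstarS idS); exact: linearP.
rewrite -[LHS]conjcK; congr conjc.
apply: (counit_unique (bh_coalg L) EP) => v.
apply: (can_inj (starK bstarS)); rewrite (star_tsum bstarS).
rewrite -[RHS](coalg_counitl (bh_coalg L)).
rewrite (tsum_bDelta_bstar (f := fun x y => beps x *: y)); last by lin.
apply: eq_tsum => a b; rewrite (starZ bstarS) conjcK -[bstar b in LHS]kact1.
rewrite -(tsum_eps_rmxr (f := fun k => k ▹ bstar b)); last by lin.
by rewrite tsum_scaler; apply: eq_tsum => r s; rewrite beps_kact scalerA mulrC.
Qed.

Lemma costar1 : costar 1 = 1.
Proof.
by rewrite /costar (star_alg1 (bstar_star L).1) -[1 in LHS]bantipode1 bantipodeK.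
Qed.

(** The star and S_L^{-1} each reverse the factors, so the order is kept and only the Rbar of
    [bantipodeVM] remains. *)
Lemma costarM x y :
  costar (x * y) = \tsum_(p ⊗ q <- rmxV K) (p ▹ costar x) * (q ▹ costar y).
Proof. by rewrite /costar (bstar_star L).1.2 bantipodeVM. Qed.

Lemma costar_kact k x : costar (k ▹ x) = kstar (antipode k) ▹ costar x.
Proof. by rewrite /costar (mstar_kact _ _ (bstar_star L)) bantipodeV_kact. Qed.

Lemma beps_costar x : beps (costar x) = ((beps x)^*)%C.
Proof. by rewrite -beps_bantipode bantipodeVK beps_bstar. Qed.

Lemma tsum_bDelta_costar X (f : L -> L -> X) x : is_bilinear f ->
  \tsum_(a ⊗ b <- bDelta (costar x)) f a b =
  \tsum_(a ⊗ b <- bDelta x) f (costar b) (costar a).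
Proof.
move=> fB; rewrite /costar tsum_bDelta_bantipodeV //.
rewrite (tsum_bDelta_bstar (f := fun a b => \tsum_(p ⊗ q <- rmxV K)
    f (p ▹ bantipodeV b) (q ▹ bantipodeV a))); last by lin.
apply: eq_tsum => a b; rewrite tsum_exch.
rewrite -[bantipodeV (bstar a) in RHS]kact1 -[bantipodeV (bstar b) in RHS]kact1.
rewrite -(tsum_rmxVK (f := fun k l =>
   f (k ▹ bantipodeV (bstar b)) (l ▹ bantipodeV (bstar a)))); last by lin.
by do 2![apply: eq_tsum => ? ?]; rewrite !bantipodeV_kact !kactM.
Qed.

End BraidedStar.

(** * The conjugate action *)

Section Succ.
Variables (R : realType) (K : qtHopfStarAlgebra R).
Variables (L : braidedHopfStarAlgebra K) (A : moduleStarAlgebra K).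
Variable act : L -> A -> A.
Hypothesis rmx_unitary : \tsum_(r ⊗ r' <- rmx K) kstar r ⊗ kstar r' = rmxV K.
Hypothesis actP : is_braided_action act.
Implicit Types (k : K) (x y : L) (a b : A).

Let actB : is_bilinear act := bract_bilinear actP.
Let S_bij : bijective (@antipode R K) := antipode_bij K.
Let SL_bij : bijective (@bantipode R K L) := bantipode_bij L.
Let bstarS : is_star (@bstar R K L) := (bstar_star L).1.1.
Let mstarS : is_star (@mstar R K A) := (mstar_star A).1.1.
Let mstarK : involutive (@mstar R K A) := starK mstarS.
Notation SV := (inv_map (@antipode R K)).

Lemma compat_rhsE x a :
  compat_rhs act x a =
  \tsum_(p ⊗ q <- rmxV K) act (p ▹ costar x) (q ▹ mstar a).
Proof. by []. Qed.

(** The unitarity of R enters here: since [kstar] ∘ S = S^{-1} ∘ [kstar], the left side is (S^{-1} ⊗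
    S^{-1}) Rbar, and that is Rbar. *)
Lemma tsum_kstar_antipode_rmx (X : lmodType R[i]) (f : K -> K -> X) : is_bilinear f ->
  \tsum_(r ⊗ s <- rmx K) f (kstar (antipode r)) (kstar (antipode s)) =
  \tsum_(p ⊗ q <- rmxV K) f p q.
Proof.
move=> fB; rewrite -[RHS]tsum_antipodeV_rmxV // -rmx_unitary tsum_tsum; last by lin.
by apply: eq_tsum => r s; rewrite tsum_tens ?antipodeV_kstar //; lin.
Qed.

Lemma succ_act_bilinear : is_bilinear (succ_act act).
Proof.
split=> [a|x].
  apply: (star_conj_linear (f := fun x => \tsum_(p ⊗ q <- rmxV K)
    act (p ▹ inv_map bantipode x) (q ▹ mstar a)) bstarS mstarS); by lin.
apply: (star_conj_linear (f := fun a => \tsum_(p ⊗ q <- rmxV K)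
    act (p ▹ costar x) (q ▹ a)) mstarS mstarS); by lin.
Qed.

Lemma succ_act1 a : succ_act act 1 a = a.
Proof.
apply: (can_inj mstarK); rewrite /succ_act mstarK compat_rhsE costar1.
rewrite -[RHS]kact1 -(tsum_eps_rmxVl (f := fun k => k ▹ mstar a)); last by lin.
by apply: eq_tsum => p q; rewrite kact_unit (linZ _ _ (actB.1 _)) (bract1 actP).
Qed.

(** The two sides are the stars of (xy) ≻ a and x ≻ (y ≻ a). On the legs [costar x], [costar y],
    [mstar a] they carry Rbar_23 Rbar_13 Rbar_12, with Rbar_12 from [costarM], and Rbar_12 Rbar_13
    Rbar_23, with Rbar_23 from the inner action. *)
Lemma compat_rhsM x y a :
  compat_rhs act (x * y) a = compat_rhs act x (mstar (compat_rhs act y a)).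
Proof.
pose f (k h l : K) := act (k ▹ costar x) (act (h ▹ costar y) (l ▹ mstar a)).
have fT : trilinear f by rewrite /f; lin.
transitivity (\tsum_(a ⊗ b <- rmxV K) \tsum_(a' ⊗ c <- rmxV K)
    \tsum_(b' ⊗ c' <- rmxV K) f (a' * a) (b' * b) (c' * c)).
  rewrite compat_rhsE.
  transitivity (\tsum_(p ⊗ q <- rmxV K) \tsum_(a ⊗ b <- rmxV K)
      \tsum_(p1 ⊗ p2 <- Delta p) f (p1 * a) (p2 * b) q).
    apply: eq_tsum => p q; rewrite costarM.
    rewrite (linear_tsumE (g := fun z => act (p ▹ z) (q ▹ mstar a))); last by lin.
    apply: eq_tsum => p' q'.
    rewrite -(tsum_kact_mul (f := fun z => act z (q ▹ mstar a))); last by lin.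
    by apply: eq_tsum => p1 p2; rewrite (bractM actP) /f !kactM.
  rewrite [LHS]tsum_exch; apply: eq_tsum => p q.
  by rewrite (tsum_rmxV_Deltal (f := fun u v w : K => f (u * p) (v * q) w)) //; lin.
rewrite -yang_baxter // [in RHS]compat_rhsE mstarK.
transitivity (\tsum_(p ⊗ q <- rmxV K) \tsum_(q1 ⊗ q2 <- Delta q)
    \tsum_(p' ⊗ q' <- rmxV K) f p (q1 * p') (q2 * q')).
  by rewrite (tsum_rmxV_Deltar (f := fun u v w : K =>
    tsum (rmxV K) (fun p q => f u (v * p) (w * q)))) //; lin.
apply: eq_tsum => p q; rewrite compat_rhsE.
rewrite (linear_tsumE (g := fun z => act (p ▹ costar x) (q ▹ z))); last by lin.
rewrite tsum_exch; apply: eq_tsum => p' q'.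
rewrite (bract_kact actP) (linear_tsumE (g := act (p ▹ costar x))); last by lin.
by apply: eq_tsum => q1 q2; rewrite /f !kactM.
Qed.

(** Under the star, k becomes S^{-1}(k^* ), whose coproduct is reversed; passing it across Rbar by
    [tsum_Delta_rmxV] reverses it once more. *)
Lemma succ_act_kact k x a :
  k ▹ succ_act act x a =
  \tsum_(h ⊗ l <- Delta k) succ_act act (h ▹ x) (l ▹ a).
Proof.
apply: (can_inj mstarK); rewrite (star_tsum mstarS) (mstar_kact _ _ (mstar_star A)).
rewrite /succ_act mstarK -antipodeV_kstar.
pose f (h l : K) := act (h ▹ costar x) (l ▹ mstar a).
have fB : is_bilinear f by rewrite /f; lin.
transitivity (\tsum_(a ⊗ b <- Delta (SV (kstar k))) \tsum_(p ⊗ q <- rmxV K)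
    f (a * p) (b * q)).
  rewrite compat_rhsE (linear_tsumE (g := kact _)); last by lin.
  rewrite [RHS]tsum_exch; apply: eq_tsum => p q; rewrite (bract_kact actP).
  by apply: eq_tsum => h l; rewrite /f !kactM.
rewrite tsum_Delta_rmxV //.
rewrite (tsum_Delta_antipodeV (f := fun a b : K =>
  \tsum_(p ⊗ q <- rmxV K) f (p * b) (q * a))); last by lin.
rewrite (tsum_Delta_kstar (f := fun a b : K =>
  \tsum_(p ⊗ q <- rmxV K) f (p * SV a) (q * SV b))); last by lin.
apply: eq_tsum => h l; rewrite mstarK compat_rhsE; apply: eq_tsum => p q.
by rewrite /f !kactM !antipodeV_kstar costar_kact (mstar_kact _ _ (mstar_star A)).
Qed.

Lemma succ_act_unit x : succ_act act x 1 = beps x *: (1 : A).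
Proof.
apply: (can_inj mstarK); rewrite /succ_act mstarK (starZ mstarS).
rewrite compat_rhsE (star_alg1 (mstar_star A).1) -beps_costar.
rewrite -[costar x in RHS]kact1.
rewrite -(tsum_eps_rmxVr (f := fun k => beps (k ▹ costar x) *: (1 : A))); last by lin.
apply: eq_tsum => p q; rewrite kact_unit (linZ _ _ (actB.2 _)).
by rewrite (bract_unit actP).
Qed.

Lemma succ_act_mul x a b :
  succ_act act x (a * b) =
  \tsum_(y ⊗ z <- bDelta x) \tsum_(r ⊗ s <- rmx K)
    succ_act act y (s ▹ a) * succ_act act (r ▹ z) b.
Proof.
apply: (can_inj mstarK); rewrite (star_tsum mstarS) {1}/succ_act mstarK.
pose f (v w : L) (k h k' h' : K) :=
  act (k ▹ v) (h ▹ mstar b) * act (k' ▹ w) (h' ▹ mstar a).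
(* Number the legs [costar z], [costar y], [mstar b], [mstar a] from 1 to 4; they receive the
   arguments k, k', h, h' of [f] respectively. The target is then Rbar_13 Rbar_24 Rbar_14. *)
transitivity (\tsum_(y ⊗ z <- bDelta x) \tsum_(p ⊗ q <- rmxV K)
    \tsum_(p' ⊗ q' <- rmxV K) \tsum_(p'' ⊗ q'' <- rmxV K)
      f (costar z) (costar y) (p * p') q p'' (q'' * q')); last first.
  apply: eq_tsum => y z; rewrite (star_tsum mstarS).
  (* Pulling the star through the actions of r and s turns R into ([kstar] ∘ S)^{⊗2} R, which is the
     factor Rbar_14. *)
  transitivity (\tsum_(r ⊗ s <- rmx K) \tsum_(p ⊗ q <- rmxV K)
      \tsum_(p'' ⊗ q'' <- rmxV K)
      f (costar z) (costar y) (p * kstar (antipode r)) q p''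
        (q'' * kstar (antipode s))).
    rewrite (tsum_kstar_antipode_rmx (f := fun k l => \tsum_(p ⊗ q <- rmxV K)
      \tsum_(p'' ⊗ q'' <- rmxV K) f (costar z) (costar y) (p * k) q p'' (q'' * l))).
      by rewrite [LHS]tsum_exch.
    by rewrite /f; lin.
  apply: eq_tsum => r s; rewrite (mstar_star A).1.2 /succ_act !mstarK !compat_rhsE.
  rewrite tsum_mull; apply: eq_tsum => p q; rewrite tsum_mulr.
  apply: eq_tsum => p'' q''.
  by rewrite /f !kactM costar_kact (mstar_kact _ _ (mstar_star A)).
rewrite compat_rhsE (mstar_star A).1.2.
transitivity (\tsum_(p ⊗ q <- rmxV K) \tsum_(p' ⊗ q' <- rmxV K)
    act ((p * p') ▹ costar x) ((q ▹ mstar b) * (q' ▹ mstar a))).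
  rewrite -(tsum_rmxV_Deltar (f := fun k h l : K =>
    act (k ▹ costar x) ((h ▹ mstar b) * (l ▹ mstar a)))); last by lin.
  by apply: eq_tsum => p q; rewrite (tsum_kact_mul (f := act (p ▹ costar x))) //; lin.
(* The product rule of [act] adds R_23 on the left, and the coproducts of p and p' distribute over
   legs 1 and 2 because [tsum_bDelta_costar] contributes no braiding. *)
transitivity (\tsum_(p ⊗ q <- rmxV K) \tsum_(p' ⊗ q' <- rmxV K)
    \tsum_(y ⊗ z <- bDelta x) \tsum_(p1 ⊗ p2 <- Delta p)
    \tsum_(p1' ⊗ p2' <- Delta p') \tsum_(r ⊗ s <- rmx K)
      f (costar z) (costar y) (p1 * p1') (s * q) (r * (p2 * p2')) q').
  apply: eq_tsum => p q; apply: eq_tsum => p' q'; rewrite (bract_mul actP).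
  pose g (v w : L) := \tsum_(r ⊗ s <- rmx K)
    act v (s ▹ q ▹ mstar b) * act (r ▹ w) (q' ▹ mstar a).
  have gB : is_bilinear g by rewrite /g; lin.
  transitivity (tsum (bDelta ((p * p') ▹ costar x)) g); first by [].
  rewrite tsum_bDelta_kact // tsum_bDelta_costar; last by lin.
  apply: eq_tsum => y z.
  rewrite (tsum_DeltaM (f := fun k l : K => g (k ▹ costar z) (l ▹ costar y)));
    last by lin.
  do 2![apply: eq_tsum => ? ?]; rewrite /g; apply: eq_tsum => r s.
  by rewrite /f !kactM.
transitivity (\tsum_(y ⊗ z <- bDelta x) \tsum_(p ⊗ q <- rmxV K)
    \tsum_(p' ⊗ q' <- rmxV K) \tsum_(p1 ⊗ p2 <- Delta p)
    \tsum_(p1' ⊗ p2' <- Delta p') \tsum_(r ⊗ s <- rmx K)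
      f (costar z) (costar y) (p1 * p1') (s * q) (r * (p2 * p2')) q').
  rewrite [RHS]tsum_exch; apply: eq_tsum => p q.
  by rewrite [RHS]tsum_exch.
apply: eq_tsum => y z; move: (costar y) (costar z) => w v.
pose g (k l m : K) := \tsum_(p' ⊗ q' <- rmxV K) \tsum_(p1' ⊗ p2' <- Delta p')
  \tsum_(r ⊗ s <- rmx K) f v w (k * p1') (s * m) (r * (l * p2')) q'.
transitivity (\tsum_(p ⊗ q <- rmxV K) \tsum_(p1 ⊗ p2 <- Delta p) g p1 p2 q).
  by apply: eq_tsum => p q; rewrite tsum_exch.
(* The first Rbar splits into Rbar_23 Rbar_13, which places Rbar_23 next to R_23. *)
rewrite tsum_rmxV_Deltal; last by rewrite /g /f; lin.
apply: eq_tsum => p q.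
(* Rbar_24 Rbar_14 on the target side is folded back into one Rbar with a coproduct, matching the
   unsplit second Rbar on the left. *)
rewrite -(tsum_rmxV_Deltal (f := fun k l m : K => f v w (p * k) q l m)); last by rewrite /f; lin.
rewrite /g tsum_exch; apply: eq_tsum => p' q'.
rewrite tsum_exch; apply: eq_tsum => p1 p2.
(* The inserted units on legs 3 and 2 are replaced by R_23 Rbar_23. *)
rewrite -[q in RHS]mul1r -[p2 in RHS]mul1r.
rewrite -(tsum_rmxK (f := fun k l : K => f v w (p * p1) (l * q) (k * p2) q')).
  by rewrite [RHS]tsum_exch; do 2![apply: eq_tsum => ? ?]; rewrite !mulrA.
by rewrite /f; lin.
Qed.

End Succ.

Theorem proposition3p6 (R : realType) (K : qtHopfStarAlgebra R)
    (L : braidedHopfStarAlgebra K) (A : moduleStarAlgebra K)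
    (act : L -> A -> A) :
  \tsum_(r ⊗ r' <- rmx K) kstar r ⊗ kstar r' = rmxV K ->
  is_braided_action act ->
  is_braided_action (succ_act act) /\
  (star_compatible act <-> forall x a, succ_act act x a = act x a).
Proof.
move=> rmx_unitary actP; have mstarS := (mstar_star A).1.1; split.
  split.
  - exact: succ_act_bilinear.
  - exact: succ_act1.
  - by move=> x y a; rewrite {1}/succ_act compat_rhsM.
  - exact: succ_act_kact.
  - exact: succ_act_unit.
  - exact: succ_act_mul.
split=> [cP x a|sP x a]; first by rewrite /succ_act -cP (starK mstarS).
by rewrite -sP /succ_act (starK mstarS).
Qed.
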